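(* Let $r_1,r_2,m_1,m_2>0$ with $r_1+r_2\le1$, $m_1+m_2=1$ and $r_1m_1=r_2m_2$, and let $\mu$ be the self-similar measure on $[0,1]$ determined by $S_1(x)=r_1x$, $S_2(x)=r_2x+1-r_2$ and weights $(m_1,m_2)$. For $m\in\mathbb{N}=\{1,2,\dots\}$ let $v(m)$ be the multiplicity of the prime factor $2$ in $m$. Then, for all $m\in\mathbb{N}$, $$\|\tilde f_{2m}\|_\infty=\frac{\max\Bigl\{1,\bigl(\frac{m_1}{m_2}\bigr)^{2^{v(m)}}\Bigr\}}{\sqrt{m_1+m_2\bigl(\frac{m_1}{m_2}\bigr)^{2^{v(m)+1}}}}\ \|\tilde f_m\|_\infty.$$ Suppose moreover that $m_1\le m_2$ and let $l\in\mathbb{N}$ be odd. Then, for all $k\in\mathbb{N}$, $$\|\tilde f_{2^kl}\|_\infty=m_1^{-\frac k2}\prod_{j=1}^k\Bigl(1+\Bigl(\frac{m_1}{m_2}\Bigr)^{2^j-1}\Bigr)^{-\frac12}\,\|\tilde f_l\|_\infty.$$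
   Context: The self-similar measure $\mu$ is the unique Borel probability measure on $[0,1]$ with $\mu(B)=m_1\,\mu(S_1^{-1}(B))+m_2\,\mu(S_2^{-1}(B))$ for all Borel sets $B$ (it is non-atomic). Derivatives with respect to a measure: for a non-atomic Borel probability measure $\nu$ on $[0,1]$ and $f\colon[0,1]\to\mathbb{R}$, $h\in L_2([0,1],\nu)$ is the $\nu$-derivative $\frac{df}{d\nu}$ of $f$ if $f(x)=f(0)+\int_0^x h\,d\nu$ for all $x\in[0,1]$. $H^1(\nu)$ is the space of functions possessing a $\nu$-derivative. For Lebesgue measure the derivative is written $f'$. $H^2(\lambda,\mu)$ (index $\lambda$: Lebesgue measure) is the space of all $f$ possessing a Lebesgue derivative $f'$ (that is, $f'$ is square-integrable with respect to Lebesgue measure and $f(x)=f(0)+\int_0^x f'(t)\,dt$ for all $x\in[0,1]$) belonging to $H^1(\mu)$ (so $f'$ is taken continuous). A Neumann eigenvalue is a real $\Lambda$ such that there is a non-zero $f\in H^2(\lambda,\mu)$ with $\frac{d}{d\mu}f'=-\Lambda f$, $f'(0)=f'(1)=0$. The Neumann eigenvalues form a strictly increasing sequence $0=\lambda_{N,0}<\lambda_{N,1}<\cdots\to\infty$; they are exactly the squares of the non-negative zeros of $\sin_\mu^N(z)=\sum_{n\ge0}(-1)^n p_{2n+1}(1)z^{2n+1}$. Here $p_0(x)=1$ and, for $n\ge1$, $p_n(x)=\int_0^x p_{n-1}\,d\mu$ if $n$ is odd, $p_n(x)=\int_0^x p_{n-1}(t)\,dt$ if $n$ is even. The $m$th Neumann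 eigenfunction is $f_m(x)=c_{\lambda,\mu}(\sqrt{\lambda_{N,m}},x)$ with $c_{\lambda,\mu}(z,x)=\sum_{n\ge0}(-1)^n z^{2n}p_{2n}(x)$, and $\tilde f_m=\|f_m\|_{L_2(\mu)}^{-1}f_m$. $\|\cdot\|_\infty$ is the supremum norm on $[0,1]$. Known fact used throughout (due to Volkmer and Freiberg): if $r_1m_1=r_2m_2$ then $r_1m_1\,\lambda_{N,2m}=\lambda_{N,m}$ for all $m\in\mathbb{N}$. *)

(* Defs.v *)
From HB Require Import structures.
From mathcomp Require Import all_boot all_order all_algebra.
From mathcomp Require Import all_classical all_reals all_analysis.

Set Implicit Arguments.
Unset Strict Implicit.
Unset Printing Implicit Defensive.

Import Order.TTheory GRing.Theory Num.Theory numFieldNormedType.Exports.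

Local Open Scope classical_set_scope.
Local Open Scope ring_scope.

(* A measure on [0, 1] is represented by a measure on the line that is
   carried by [0, 1], and a function on [0, 1] by a function on the line of
   which only the values on [0, 1] are used. *)

Definition self_similar_measure (R : realType) (r1 r2 m1 m2 : R)
    (mu : probability (measurableTypeR R) R) : Prop :=
  [/\ mu `[0, 1]%classic = 1%E
    & forall B : set (measurableTypeR R),
        measurable B -> B `<=` `[0, 1]%classic ->
        mu B = (m1%:E * mu ((fun x : R => (r1 * x)%R) @^-1` B)
              + m2%:E * mu ((fun x : R => (r2 * x + 1 - r2)%R) @^-1` B))%E].

(* h is square-integrable and f(x) = f(0) + \int_0^x h dnu on [0, 1].  For
   non-atomic nu it is immaterial that the integral is taken over the closed
   interval [0, x]. *)
Definition is_measure_derivative (R : realType)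
    (nu : {measure set (measurableTypeR R) -> \bar R}) (f h : R -> R) : Prop :=
  [/\ measurable_fun (`[0, 1] : set (measurableTypeR R)) h,
      nu.-integrable `[0, 1]%classic (fun x => ((h x) ^+ 2)%:E)
    & forall x : R, 0 <= x <= 1 ->
        f x = f 0 + \int[nu]_(t in `[0, x]) h t].

(* The conditions on g say that g is the continuous version of f' and that
   f belongs to H^2(lambda, mu): g has the mu-derivative - L f. *)
Definition neumann_eigenvalue (R : realType)
    (mu : {measure set (measurableTypeR R) -> \bar R}) (L : R) : Prop :=
  exists f g : R -> R,
    [/\ exists2 x : R, 0 <= x <= 1 & f x != 0,
        is_measure_derivative lebesgue_measure f g,
        is_measure_derivative mu g (fun x => - L * f x),
        g 0 = 0
      & g 1 = 0].

(* These two conditions determine lam, the sequence lambda_{N,0} <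
   lambda_{N,1} < ... of all Neumann eigenvalues. *)
Definition neumann_spectrum (R : realType)
    (mu : {measure set (measurableTypeR R) -> \bar R}) (lam : nat -> R) : Prop :=
  {homo lam : i j / (i < j)%N >-> i < j} /\
  range lam = [set L | neumann_eigenvalue mu L].

Fixpoint p_fun (R : realType)
    (mu : {measure set (measurableTypeR R) -> \bar R}) (n : nat) : R -> R :=
  match n with
  | 0%N => fun=> 1
  | k.+1 => if odd k.+1 then fun x => \int[mu]_(t in `[0, x]) p_fun mu k t
            else fun x => \int[lebesgue_measure]_(t in `[0, x]) p_fun mu k t
  end.

Definition c_fun (R : realType)
    (mu : {measure set (measurableTypeR R) -> \bar R}) (z x : R) : R :=
  limn (series (fun n => (-1) ^+ n * z ^+ (2 * n) * p_fun mu (2 * n) x)).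

Definition neumann_eigenfunction (R : realType)
    (mu : {measure set (measurableTypeR R) -> \bar R}) (lam : nat -> R)
    (m : nat) : R -> R :=
  c_fun mu (Num.sqrt (lam m)).

(* The norm of L_2([0, 1], mu) for mu carried by [0, 1]. *)
Definition L2norm (R : realType)
    (mu : {measure set (measurableTypeR R) -> \bar R}) (f : R -> R) : R :=
  fine ('N[mu]_2%:E [EFin \o f]).

Definition normalized_eigenfunction (R : realType)
    (mu : {measure set (measurableTypeR R) -> \bar R}) (lam : nat -> R)
    (m : nat) : R -> R :=
  fun x => (L2norm mu (neumann_eigenfunction mu lam m))^-1
           * neumann_eigenfunction mu lam m x.

Definition sup_norm (R : realType) (f : R -> R) : R :=
  sup [set `|f x| | x in `[0, 1]%classic].

(* Main.v *)
(* The solution of d/dmu f' = - L f with f(0) = 1, f'(0) = 0 is C_L(x) =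
   c_{lambda,mu}(sqrt L, x), and L is a Neumann eigenvalue iff the derivative
   of C_L vanishes at 1. Put K = r1 m1 L. By self-similarity C_L(r1 y) = C_K(y),
   C_L is affine on the gap, and y |-> C_L(r2 y + 1 - r2) solves the equation
   for K. Hence, if K is an eigenvalue, so is L, and C_L consists of a copy of
   C_K, the constant C_K(1) and C_K(1) times a copy of C_K, so that
   C_L(1) = C_K(1)^2 > 0. If L is an eigenvalue and K is not, the constancy of
   the Wronskian of C_K and y |-> C_L(r2 y + 1 - r2) gives
   C_L(1) = - m1 / m2 < 0. On the other hand the Wronskian of C_L and C_M, which
   grows from 0 to (L - M) times the mu-integral of C_L C_M, shows that C_L(1)
   changes sign between consecutive eigenvalues. So the eigenvalues of the first
   kind are those of even index, which yields r1 m1 lambda_{2m} = lambda_m,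
   |f_m(1)| = (m1 / m2)^(2^v(m)), and both norms of f_{2m} in terms of those of
   f_m. *)

Require Import Defs.
From HB Require Import structures.
From mathcomp Require Import all_boot all_order all_algebra.
From mathcomp Require Import all_classical all_reals all_analysis.
From mathcomp Require Import measurable_realfun ring lra.

Set Implicit Arguments.
Unset Strict Implicit.
Unset Printing Implicit Defensive.

Import Order.TTheory GRing.Theory Num.Theory numFieldNormedType.Exports.

Local Open Scope classical_set_scope.
Local Open Scope ring_scope.

(** * Bounded measurable functions on [0, 1] *)

Section BoundedMeasurable.
Variable R : realType.
Local Notation T := (measurableTypeR R).
Local Notation I := (`[0, 1]%classic : set T).

(** Derivatives exist only in the integrated sense and [mu] may be singular, so the eigenvalue
    equation is replaced by one Volterra equation f = A + B x - L [kern] f. The slope f' is then an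
    explicit [mu]-integral, and uniqueness, dependence on L and the Wronskian identity come from
    integral estimates and Fubini. Bounded measurable functions are the working class: it is stable
    under products, primitives and composition with S1 and S2, and its members are integrable for
    every measure finite on [0, 1]. The cosine is a function of the real parameter L instead of z =
    sqrt L, since an eigenvalue is a priori any real number. Positivity excludes L < 0, so that
    lambda_{N,0} = 0, where C = 1; this is the start of the parity count. The doubling of indices is
    then pure order theory: j |-> c lambda_j maps the even-indexed eigenvalues increasingly onto all
    of them, and there is only one way to do so. *)

Definition bounded_measurable (f : R -> R) : Prop :=
  measurable_fun I f /\ exists M : R, forall x : R, 0 <= x <= 1 -> `|f x| <= M.

Lemma bm_cst (a : R) : bounded_measurable (fun=> a).
Proof. by split; [exact: measurable_cst|exists `|a|]. Qed.

Lemma bm_id : bounded_measurable id.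
Proof.
split; first exact: measurable_id.
by exists 1 => x /andP[x0 x1]; rewrite ger0_norm.
Qed.

Lemma bmD (f g : R -> R) : bounded_measurable f -> bounded_measurable g ->
  bounded_measurable (fun x => f x + g x).
Proof.
move=> [mf [M Mf]] [mg [N Ng]]; split; first exact: measurable_funD.
exists (M + N) => x x01; rewrite (le_trans (ler_normD _ _))//.
by rewrite lerD ?Mf ?Ng.
Qed.

Lemma bmM (f g : R -> R) : bounded_measurable f -> bounded_measurable g ->
  bounded_measurable (fun x => f x * g x).
Proof.
move=> [mf [M Mf]] [mg [N Ng]]; split; first exact: measurable_funM.
by exists (M * N) => x x01; rewrite normrM ler_pM ?Mf ?Ng.
Qed.

Lemma bmZ (a : R) (f : R -> R) : bounded_measurable f ->
  bounded_measurable (fun x => a * f x).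
Proof. by move=> bf; apply: bmM => //; exact: bm_cst. Qed.

Lemma bmN (f : R -> R) : bounded_measurable f ->
  bounded_measurable (fun x => - f x).
Proof.
by move=> /(bmZ (-1)); congr bounded_measurable; apply/funext => x; rewrite mulN1r.
Qed.

Lemma bmB (f g : R -> R) : bounded_measurable f -> bounded_measurable g ->
  bounded_measurable (fun x => f x - g x).
Proof. by move=> bf bg; apply: bmD => //; exact: bmN. Qed.

Lemma bm_norm (f : R -> R) : bounded_measurable f ->
  bounded_measurable (fun x => `|f x|).
Proof.
move=> [mf [M Mf]]; split; first exact: measurableT_comp.
by exists M => x x01; rewrite normr_id Mf.
Qed.

Lemma bm_if_le (y : R) (f : R -> R) : bounded_measurable f ->
  bounded_measurable (fun x => if x <= y then f x else 0).
Proof.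
move=> [mf [M Mf]]; split.
  apply: measurable_fun_if => //; first exact: measurable_fun_ler.
  - by apply: measurable_funS mf => // x [].
exists M => x x01; case: ifPn => _; first exact: Mf.
by rewrite normr0 (le_trans _ (Mf _ x01)).
Qed.

Lemma eq_bm (f g : R -> R) : (forall x, 0 <= x <= 1 -> f x = g x) ->
  bounded_measurable f -> bounded_measurable g.
Proof.
move=> fg [mf [M Mf]]; split.
  by apply: eq_measurable_fun mf => x; rewrite inE/= in_itv/= => /fg.
by exists M => x x01; rewrite -fg// Mf.
Qed.

Lemma bm_comp_affine (a b : R) (f : R -> R) :
  (forall x, 0 <= x <= 1 -> 0 <= a * x + b <= 1) ->
  bounded_measurable f -> bounded_measurable (fun x => f (a * x + b)).
Proof.
move=> ab [mf [M Mf]]; split; last by exists M => x /ab /Mf.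
apply: (@measurable_comp _ _ _ T T R I f _ (fun x => a * x + b)) => //.
- by move=> _ [x /= + <-]; rewrite !in_itv/=; exact: ab.
- by apply: measurable_funD => //; exact: measurable_funM.
Qed.

Lemma bm_integrable (nu : {measure set T -> \bar R}) (D : set T) (f : R -> R) :
  (nu I < +oo)%E -> measurable D -> D `<=` I -> bounded_measurable f ->
  nu.-integrable D (EFin \o f).
Proof.
move=> nuI mD DI [mf [M Mf]].
apply: (@integrableS _ _ _ nu I) => //.
apply: measurable_bounded_integrable => //.
exists M; split; first exact: num_real.
move=> N MN x /=; rewrite in_itv/= => x01.
by rewrite (le_trans (Mf x x01))// ltW.
Qed.

End BoundedMeasurable.

(** * Fubini on the unit square *)

Section Fubini.
Variable R : realType.
Local Notation T := (measurableTypeR R).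
Local Notation I := (`[0, 1]%classic : set T).
Variables n1 n2 : {sigma_finite_measure set T -> \bar R}.
Hypotheses (n1I : (n1 I < +oo)%E) (n2I : (n2 I < +oo)%E).

(** Both parts come from the integrable extension of h by zero to the plane. The first part is what
    later makes primitives measurable. *)
Lemma fubini_square (h : R -> R -> R) (M : R) :
  measurable_fun (I `*` I : set (T * T)) (fun z => h z.1 z.2) ->
  (forall x y, 0 <= x <= 1 -> 0 <= y <= 1 -> `|h x y| <= M) ->
  bounded_measurable (fun x => \int[n2]_(y in I) h x y) /\
  \int[n1]_(x in I) \int[n2]_(y in I) h x y =
  \int[n2]_(y in I) \int[n1]_(x in I) h x y.
Proof.
move=> mh hM.
have mI : measurable I by exact: measurable_itv.
have mII : measurable (I `*` I : set (T * T)) by exact: measurableX.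
pose H : T * T -> R := (fun z => h z.1 z.2) \_ (I `*` I).
have IHint : (n1 \x n2)%E.-integrable setT (EFin \o H).
  have := @integrable_mkcond _ _ _ (n1 \x n2)%E (I `*` I)
    (EFin \o (fun z => h z.1 z.2)) mII.
  rewrite restrict_EFin => -[+ _]; apply.
  apply: measurable_bounded_integrable => //.
    move: (product_measure1E n1 n2 mI mI); rewrite /= => ->.
    by rewrite lte_mul_pinfty// ge0_fin_numE.
  exists M; split; first exact: num_real.
  move=> N MN [x y] [/=]; rewrite !in_itv/= => x01 y01.
  by rewrite (le_trans (hM _ _ x01 y01))// ltW.
have hx x : x \in I -> n2.-integrable I (EFin \o h x).
  rewrite inE => xI; apply: measurable_bounded_integrable => //.
    apply: (@measurable_comp _ _ _ T (T * T)%type T (I `*` I)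
      (fun z => h z.1 z.2) I (pair x)) => //; last first.
      exact/measurable_funTS/measurable_fun_pair.
    by move=> _ [y yI <-].
  exists M; split; first exact: num_real.
  move=> N MN y /= yI; rewrite (le_trans _ (ltW MN))//.
  by apply: hM; [move: xI|move: yI]; rewrite /= in_itv.
have hy y : y \in I -> n1.-integrable I (EFin \o h^~ y).
  rewrite inE => yI; apply: measurable_bounded_integrable => //.
    apply: (@measurable_comp _ _ _ T (T * T)%type T (I `*` I)
      (fun z => h z.1 z.2) I (fun x => (x, y))) => //; last first.
      exact/measurable_funTS/measurable_fun_pair.
    by move=> _ [x xI <-].
  exists M; split; first exact: num_real.
  move=> N MN x /= xI; rewrite (le_trans _ (ltW MN))//.
  by apply: hM; [move: xI|move: yI]; rewrite /= in_itv.
have FE : (fun x => \int[n2]_y (EFin \o H) (x, y))%E =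
    EFin \o (fun x => \int[n2]_(y in I) h x y) \_ I.
  apply/funext => x /=; rewrite patchE; case: ifPn => xI.
    rewrite /Rintegral fineK; last exact: integrable_fin_num (hx x xI).
    rewrite [RHS]integral_mkcond; apply: eq_integral => y _.
    rewrite /= /H !patchE in_setX /= xI/=.
    by case: ifPn.
  rewrite integral0_eq// => y _.
  by rewrite /= /H patchE in_setX/= (negbTE xI).
have GE : (fun y => \int[n1]_x (EFin \o H) (x, y))%E =
    EFin \o (fun y => \int[n1]_(x in I) h x y) \_ I.
  apply/funext => y /=; rewrite patchE; case: ifPn => yI.
    rewrite /Rintegral fineK; last exact: integrable_fin_num (hy y yI).
    rewrite [RHS]integral_mkcond; apply: eq_integral => x _.
    rewrite /= /H !patchE in_setX /= yI andbT.
    by case: ifPn.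
  rewrite integral0_eq// => x _.
  by rewrite /= /H patchE in_setX/= (negbTE yI) andbF.
split; last first.
  rewrite Rintegral_mkcond [RHS]Rintegral_mkcond /Rintegral.
  congr fine.
  by move: (Fubini IHint); rewrite FE GE.
split.
  apply/(measurable_restrictT _ mI)/measurable_EFinP.
  rewrite -[X in measurable_fun _ X]FE.
  exact: measurable_fubini_F IHint.
exists (M * fine (n2 I)) => x x01.
have xI : x \in I by rewrite inE/= in_itv.
apply: (le_trans (le_normr_Rintegral _ (hx x xI))) => //.
rewrite -Rintegral_cst//; apply: le_Rintegral => //.
- have -> : (EFin \o (fun t => `|h x t|)) = (abse \o (EFin \o h x)) by [].
  exact: integrable_abse (hx x xI).
- apply: measurable_bounded_integrable => //.
  exists `|M|; split; first exact: num_real.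
  by move=> N MN z _; rewrite ltW.
- by move=> y /=; rewrite in_itv/= => y01; apply: hM.
Qed.

End Fubini.

(** * Integrals over [0, x] and integration by parts *)

Section IntervalIntegrals.
Variable R : realType.
Local Notation T := (measurableTypeR R).
Local Notation I := (`[0, 1]%classic : set T).
Implicit Types (nu : {measure set T -> \bar R}).

(** Cutting off the integrand in place of the domain makes iterated integrals with variable bounds
    accessible to [fubini_square]. *)
Lemma Rintegral_sub_itv nu (a b : R) (f : R -> R) : 0 <= a -> b <= 1 ->
  \int[nu]_(t in `[a, b]) f t =
  \int[nu]_(t in I) (if (a <= t) && (t <= b) then f t else 0).
Proof.
move=> a0 b1; rewrite Rintegral_mkcond [RHS]Rintegral_mkcond.
congr Rintegral; apply/funext => t; rewrite !patchE !mem_setE !in_itv/=.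
case: ifPn => [/andP[at_ tb]|]; last by case: ifP.
by rewrite (le_trans a0 at_) (le_trans tb b1).
Qed.

Lemma Rintegral_0itv nu (b : R) (f : R -> R) : b <= 1 ->
  \int[nu]_(t in `[0, b]) f t = \int[nu]_(t in I) (if t <= b then f t else 0).
Proof.
move=> b1; rewrite Rintegral_sub_itv//; apply: eq_Rintegral => t.
by rewrite inE/= in_itv/= => /andP[-> _].
Qed.

End IntervalIntegrals.

Section Triangle.
Variable R : realType.
Local Notation T := (measurableTypeR R).
Local Notation I := (`[0, 1]%classic : set T).
Local Notation leb := (@lebesgue_measure R).

Lemma sub_itv01 (x : R) : x <= 1 -> (`[0, x]%classic : set T) `<=` I.
Proof.
by move=> x1 t /=; rewrite !in_itv/= => /andP[-> /le_trans->].
Qed.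

Lemma bm_integrable_itv (nu : {measure set T -> \bar R}) (x : R) (f : R -> R) :
  (nu I < +oo)%E -> x <= 1 -> bounded_measurable f ->
  nu.-integrable (`[0, x]%classic : set T) (EFin \o f).
Proof.
by move=> nuI x1 bf; apply: bm_integrable => //; exact: sub_itv01.
Qed.

(** A primitive may jump at atoms of [nu], so measurability is not obtained from continuity but from
    Fubini for q(s) cut off to s <= t. *)
Lemma bm_primitive (nu : {sigma_finite_measure set T -> \bar R}) (q : R -> R) :
  (nu I < +oo)%E -> bounded_measurable q ->
  bounded_measurable (fun t => \int[nu]_(s in `[0, t]) q s).
Proof.
move=> nuI [mq [M Mq]].
apply: (@eq_bm _ (fun t => \int[nu]_(s in I) (if s <= t then q s else 0))).
  by move=> t /andP[_ t1]; rewrite Rintegral_0itv.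
apply: (@fubini_square _ nu nu nuI nuI (fun t s => if s <= t then q s else 0)
  M _ _).1.
  apply: measurable_fun_if => //.
  - exact: measurableX.
  - by apply: measurable_fun_ler; exact/measurable_funTS.
  - apply: (@measurable_comp _ _ _ (T * T)%type T T I q _ snd) => //.
    + by move=> _ [[x y] [[_ yI] _] <-].
    + exact/measurable_funTS.
move=> x y _ y01; case: ifPn => _; first exact: Mq.
by rewrite normr0 (le_trans _ (Mq _ y01)).
Qed.

Lemma fubini_triangle (n1 n2 : {sigma_finite_measure set T -> \bar R})
    (p q : R -> R) (x : R) :
  (n1 I < +oo)%E -> (n2 I < +oo)%E ->
  bounded_measurable p -> bounded_measurable q -> 0 <= x <= 1 ->
  \int[n1]_(t in `[0, x]) (p t * \int[n2]_(s in `[0, t]) q s) =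
  \int[n2]_(s in `[0, x]) (q s * \int[n1]_(t in `[s, x]) p t).
Proof.
move=> n1I n2I bp bq /andP[x0 x1].
have [mp' [M Mp]] := bm_if_le x bp; have [mq [N Nq]] := bq.
rewrite [LHS]Rintegral_0itv// [RHS]Rintegral_0itv//.
(* The integrand p(t) q(s) restricted to the triangle s <= t <= x. *)
pose h t s := if s <= t then (if t <= x then p t else 0) * q s else 0.
transitivity (\int[n1]_(t in I) \int[n2]_(s in I) h t s).
  apply: eq_Rintegral => t; rewrite inE/= in_itv/= => /andP[t0 t1].
  rewrite Rintegral_0itv//.
  rewrite (_ : (if t <= x then _ else _) = (if t <= x then p t else 0) *
    \int[n2]_(s in I) (if s <= t then q s else 0)); last first.
    by case: ifP => _ //; rewrite mul0r.
  rewrite -RintegralZl//; last by apply: bm_integrable => //; exact: bm_if_le.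
  by apply: eq_Rintegral => s _; rewrite /h; case: (s <= t); rewrite ?mulr0.
rewrite (fubini_square n1I n2I (M := M * N) _ _).2; last 2 first.
  - apply: measurable_fun_if => //.
    + exact: measurableX.
    + by apply: measurable_fun_ler; exact/measurable_funTS.
    + apply: measurable_funM.
        apply: (@measurable_comp _ _ _ (T * T)%type T T I
          (fun t => if t <= x then p t else 0) _ fst) => //.
          by move=> _ [[y z] [[yI _] _] <-].
        exact/measurable_funTS.
      apply: (@measurable_comp _ _ _ (T * T)%type T T I q _ snd) => //.
        by move=> _ [[y z] [[_ zI] _] <-].
      exact/measurable_funTS.
  - move=> y z y01 z01; rewrite /h; case: ifPn => _.
      by rewrite normrM ler_pM ?Mp ?Nq.
    by rewrite normr0 mulr_ge0// (le_trans _ (Mp _ y01), le_trans _ (Nq _ z01)).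
apply: eq_Rintegral => s; rewrite inE/= in_itv/= => /andP[s0 s1].
(* For s > x no t satisfies s <= t <= x, so the inner integral is 0. *)
case: ifPn => [sx|]; last first.
  rewrite -ltNge => xs; transitivity (\int[n1]_(t in I) (0 : R)); last first.
    by rewrite Rintegral_cst// mul0r.
  apply: eq_Rintegral => t _; rewrite /h; case: ifPn => // st.
  by rewrite leNgt (lt_le_trans xs st)/= mul0r.
rewrite [X in _ = q s * X]Rintegral_sub_itv// -RintegralZl//.
  apply: eq_Rintegral => t _; rewrite /h; case: (s <= t); rewrite ?mulr0//=.
  by case: ifP => _; rewrite ?mulr0 ?mul0r// mulrC.
apply: bm_integrable => //.
have [mps [K Kp]] := bm_if_le x bp.
split.
  rewrite (_ : (fun t => _) = (fun t => if s <= t then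
    (if t <= x then p t else 0) else 0)); last first.
    by apply/funext => t; case: (s <= t).
  apply: measurable_fun_if => //; first exact: measurable_fun_ler.
  by apply: measurable_funS mps => // t [].
exists K => t t01; have := Kp t t01.
by case: (s <= t) => //=; rewrite normr0 => /(le_trans _); apply.
Qed.

Lemma lebesgue01 : (leb I < +oo)%E.
Proof. by rewrite lebesgue_measure_itv/= lte01 -EFinB ltry. Qed.

Lemma Rintegral_cst_lebesgue (a x : R) : 0 <= x ->
  \int[leb]_(t in `[0, x]) a = a * x.
Proof.
move=> x0; rewrite Rintegral_cst//; congr (a * _).
rewrite -[RHS]/(fine x%:E); congr fine.
apply: (etrans (lebesgue_measure_itv `[0, x])).
by rewrite /= lte_fin; case: ltgtP x0 => // [x0 _|<- _]; rewrite ?sube0.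
Qed.

(** Integration by parts from Fubini on the triangle. Atoms of [mu] leave no correction term: the
    only endpoint dropped is s in [s, x], and it is dropped under Lebesgue measure. *)
Lemma product_rule (mu : {sigma_finite_measure set T -> \bar R})
    (p q : R -> R) (x : R) :
  (mu I < +oo)%E -> bounded_measurable p -> bounded_measurable q ->
  0 <= x <= 1 ->
  (\int[leb]_(t in `[0, x]) p t) * \int[mu]_(t in `[0, x]) q t =
  \int[leb]_(t in `[0, x]) (p t * \int[mu]_(s in `[0, t]) q s) +
  \int[mu]_(t in `[0, x]) (q t * \int[leb]_(s in `[0, t]) p s).
Proof.
move=> muI bp bq x01; have /andP[x0 x1] := x01.
have bP : bounded_measurable (fun t => \int[leb]_(s in `[0, t]) p s).
  by apply: bm_primitive => //; exact: lebesgue01.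
have iqP : mu.-integrable (`[0, x]%classic : set T)
    (EFin \o (fun t => q t * \int[leb]_(s in `[0, t]) p s)).
  by apply: bm_integrable_itv => //; exact: bmM.
rewrite fubini_triangle//; last exact: lebesgue01.
have -> : \int[mu]_(s in `[0, x]) (q s * \int[leb]_(t in `[s, x]) p t) =
    \int[mu]_(s in `[0, x]) ((\int[leb]_(t in `[0, x]) p t) * q s -
      q s * \int[leb]_(t in `[0, s]) p t).
  apply: eq_Rintegral => s; rewrite inE/= in_itv/= => /andP[s0 sx].
  rewrite -Rintegral_itv_obnd_cbnd; last first.
    apply: bm_integrable => //; first exact: lebesgue01.
    move=> t; rewrite /= !in_itv/= => /andP[/ltW st tx].
    by rewrite (le_trans s0 st) (le_trans tx x1).
  rewrite -(@Rintegral_itvB _ _ (BLeft 0) (BRight x) s)//.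
    by rewrite mulrBr mulrC.
  by apply: bm_integrable_itv => //; exact: lebesgue01.
rewrite RintegralB//; last by apply: bm_integrable_itv => //; exact: bmZ.
rewrite RintegralZl//; last exact: bm_integrable_itv.
by rewrite subrK.
Qed.

(** The product rule with p = 1, whose Lebesgue primitive is t. It turns a double integration into a
    single [mu]-integral with kernel x - t. *)
Lemma Rintegral_primitive (mu : {sigma_finite_measure set T -> \bar R})
    (q : R -> R) (x : R) :
  (mu I < +oo)%E -> bounded_measurable q -> 0 <= x <= 1 ->
  \int[leb]_(t in `[0, x]) \int[mu]_(s in `[0, t]) q s =
  \int[mu]_(t in `[0, x]) ((x - t) * q t).
Proof.
move=> muI bq x01; have /andP[x0 x1] := x01.
have := product_rule muI (bm_cst 1) bq x01.
under [X in _ = X + _]eq_Rintegral do rewrite mul1r.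
move/(canLR (addrK _)) => <-.
rewrite Rintegral_cst_lebesgue// mul1r -RintegralZl//; last exact: bm_integrable_itv.
rewrite -RintegralB//; last 2 first.
- by apply: bm_integrable_itv => //; exact: bmZ.
- apply: bm_integrable_itv => //; apply: bmM => //.
  by apply: bm_primitive; [exact: lebesgue01|exact: bm_cst].
apply: eq_Rintegral => t; rewrite inE/= in_itv/= => /andP[t0 _].
by rewrite Rintegral_cst_lebesgue// mul1r mulrBl [q t * t]mulrC.
Qed.

End Triangle.

(** * The Volterra operator and a Gronwall estimate *)

Lemma le0_geometric (R : realType) (a b : R) :
  (forall n : nat, b <= a * 2^-1 ^+ n) -> b <= 0.
Proof.
move=> h; have lim : (fun n => a * 2^-1 ^+ n) @ \oo --> a * 0.
  apply: cvgMr; apply: cvg_expr.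
  by rewrite ger0_norm ?invr_ge0// invf_lt1// ltr1n.
rewrite -(mulr0 a) -(cvg_lim _ lim)//.
by apply: limr_ge; [exact: cvgP lim|exact: nearW h].
Qed.

Section String.
Variable R : realType.
Local Notation T := (measurableTypeR R).
Local Notation I := (`[0, 1]%classic : set T).
Local Notation leb := (@lebesgue_measure R).
Variable mu : probability T R.

Lemma probability_fin (A : set T) : measurable A -> (mu A < +oo)%E.
Proof. by move=> mA; rewrite -ge0_fin_numE// fin_num_measure. Qed.

Lemma probability_setC0 (A : set T) : measurable A -> mu A = 1%E ->
  mu (~` A) = 0%E.
Proof. by move=> mA muA; rewrite probability_setC// muA subee. Qed.

Lemma bm_int (x : R) (f : R -> R) : x <= 1 -> bounded_measurable f ->
  mu.-integrable (`[0, x]%classic : set T) (EFin \o f).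
Proof. by apply: bm_integrable_itv; exact: probability_fin. Qed.

Lemma le_normr_Rintegral_cst (M x : R) (f : R -> R) :
  x <= 1 -> bounded_measurable f -> 0 <= M ->
  (forall t, 0 <= t <= x -> `|f t| <= M) ->
  `|\int[mu]_(t in `[0, x]) f t| <= M.
Proof.
move=> x1 bf M0 fM; apply: (le_trans (le_normr_Rintegral _ (bm_int x1 bf))) => //.
apply: (@le_trans _ _ (\int[mu]_(t in `[0, x]) M)).
  apply: le_Rintegral => //.
  - by apply: bm_int => //; exact: bm_norm.
  - by apply: bm_int => //; exact: bm_cst.
rewrite Rintegral_cst// ler_piMr// -[leRHS]/(fine 1%:E) fine_le//.
  by rewrite fin_num_measure.
exact: probability_le1.
Qed.

Definition kern (f : R -> R) (x : R) : R :=
  \int[mu]_(t in `[0, x]) ((x - t) * f t).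

Lemma bm_kern_integrand (x : R) (f : R -> R) : bounded_measurable f ->
  bounded_measurable (fun t => (x - t) * f t).
Proof.
move=> bf; apply: bmM => //; apply: bmB; [exact: bm_cst|exact: bm_id].
Qed.

(** The integrand depends on x, so the kernel is split: x times a primitive of f, minus a primitive
    of t f(t). *)
Lemma bm_kern (f : R -> R) : bounded_measurable f -> bounded_measurable (kern f).
Proof.
move=> bf.
have bxf : bounded_measurable (fun t => t * f t) by apply: bmM => //; exact: bm_id.
apply: (@eq_bm _ (fun x => x * \int[mu]_(t in `[0, x]) f t -
    \int[mu]_(t in `[0, x]) (t * f t))).
  move=> x /andP[x0 x1]; rewrite -RintegralZl//; last exact: bm_int.
  rewrite -RintegralB//; last 2 first.
  - by apply: bm_int => //; exact: bmZ.
  - exact: bm_int.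
  by apply: eq_Rintegral => t _; rewrite mulrBl.
apply: bmB; last by apply: bm_primitive => //; exact: probability_fin.
apply: bmM; first exact: bm_id.
by apply: bm_primitive => //; exact: probability_fin.
Qed.

Lemma kernB (f g : R -> R) (x : R) : x <= 1 ->
  bounded_measurable f -> bounded_measurable g ->
  kern (fun t => f t - g t) x = kern f x - kern g x.
Proof.
move=> x1 bf bg; rewrite /kern -RintegralB//; last 2 first.
- by apply: bm_int => //; exact: bm_kern_integrand.
- by apply: bm_int => //; exact: bm_kern_integrand.
by apply: eq_Rintegral => t _; rewrite mulrBr.
Qed.

Lemma kernD (f g : R -> R) (x : R) : x <= 1 ->
  bounded_measurable f -> bounded_measurable g ->
  kern (fun t => f t + g t) x = kern f x + kern g x.
Proof.
move=> x1 bf bg; rewrite /kern -RintegralD//; last 2 first.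
- by apply: bm_int => //; exact: bm_kern_integrand.
- by apply: bm_int => //; exact: bm_kern_integrand.
by apply: eq_Rintegral => t _; rewrite mulrDr.
Qed.

Lemma kernZ (a : R) (f : R -> R) (x : R) : x <= 1 -> bounded_measurable f ->
  kern (fun t => a * f t) x = a * kern f x.
Proof.
move=> x1 bf; rewrite /kern -RintegralZl//; last first.
  by apply: bm_int => //; exact: bm_kern_integrand.
by apply: eq_Rintegral => t _; rewrite mulrCA.
Qed.

Lemma eq_kern (f g : R -> R) (x : R) : x <= 1 ->
  (forall t, 0 <= t <= 1 -> f t = g t) -> kern f x = kern g x.
Proof.
move=> x1 fg; apply: eq_Rintegral => t; rewrite inE/= in_itv/= => /andP[t0 tx].
by rewrite fg// t0 (le_trans tx x1).
Qed.

Lemma kern_ge0 (f : R -> R) (x : R) : x <= 1 ->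
  (forall t, 0 <= t <= 1 -> 0 <= f t) -> 0 <= kern f x.
Proof.
move=> x1 f0; apply: Rintegral_ge0 => t; rewrite /= in_itv/= => /andP[t0 tx].
by rewrite mulr_ge0 ?subr_ge0// f0// t0 (le_trans tx x1).
Qed.

Lemma le_kern_cst (M x : R) (f : R -> R) : 0 <= x <= 1 ->
  bounded_measurable f -> (forall t, 0 <= t <= 1 -> `|f t| <= M) ->
  `|kern f x| <= M.
Proof.
move=> /andP[x0 x1] bf fM.
have M0 : 0 <= M by rewrite (le_trans _ (fM 0 _))// lexx ler01.
apply: le_normr_Rintegral_cst => //; first exact: bm_kern_integrand.
move=> t /andP[t0 tx]; rewrite normrM ger0_norm ?subr_ge0//.
rewrite -[leRHS]mul1r ler_pM ?subr_ge0//; last by rewrite fM// t0 (le_trans tx x1).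
by rewrite lerBlDr (le_trans x1)// lerDl.
Qed.

(* Bielecki's weight: since (x - t) e^(w t) <= e^(w x) / w, the operator kern
   contracts by 1 / w in the norm sup |f(x)| e^(- w x). *)
Lemma le_kern_exp (w M x : R) (f : R -> R) : 0 < w -> 0 <= x <= 1 -> 0 <= M ->
  bounded_measurable f ->
  (forall t, 0 <= t <= 1 -> `|f t| <= M * expR (w * t)) ->
  `|kern f x| <= M / w * expR (w * x).
Proof.
move=> w0 /andP[x0 x1] M0 bf fM.
apply: le_normr_Rintegral_cst => //; first exact: bm_kern_integrand.
  by rewrite mulr_ge0 ?expR_ge0// divr_ge0// ltW.
move=> t /andP[t0 tx]; rewrite normrM ger0_norm ?subr_ge0//.
apply: (@le_trans _ _ ((x - t) * (M * expR (w * t)))).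
  by rewrite ler_wpM2l ?subr_ge0// fM// t0 (le_trans tx x1).
rewrite mulrCA -[leRHS]mulrA ler_wpM2l// [leRHS]mulrC ler_pdivlMr//.
rewrite [leLHS]mulrC mulrA.
have -> : expR (w * x) = expR (w * (x - t)) * expR (w * t).
  by rewrite -expRD -mulrDr subrK.
rewrite ler_wpM2r ?expR_ge0//.
by rewrite (le_trans _ (expR_ge1Dx _))// lerDr.
Qed.

(** With a = 0 this gives uniqueness of solutions; with a proportional to |L' - L| it gives
    Lipschitz dependence on the parameter. *)
Lemma gronwall (a b : R) (h : R -> R) : bounded_measurable h -> 0 <= a ->
  (forall x, 0 <= x <= 1 -> `|h x - b * kern h x| <= a) ->
  forall x, 0 <= x <= 1 -> `|h x| <= 2 * a * expR (2 * `|b| + 1).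
Proof.
(* Since |b| / w < 1/2, one application of b [kern] at least halves the weighted norm; 2 a is the
   fixed point of c |-> a + c / 2. The summand 1 keeps w positive when b = 0. *)
move=> bh a0 ha; set w := 2 * `|b| + 1.
have w0 : 0 < w by rewrite ltr_wpDl// mulr_ge0.
have [_ [M Mh]] := bh.
have M0 : 0 <= M by rewrite (le_trans _ (Mh 0 _))// lexx ler01.
have e1 x : 0 <= x -> 1 <= expR (w * x).
  by move=> x0; rewrite -expR0 ler_expR mulr_ge0// ltW.
have itr n x : 0 <= x <= 1 -> `|h x| <= (2 * a + M * 2^-1 ^+ n) * expR (w * x).
  elim: n x => [|n IHn] x x01; have /andP[x0 x1] := x01.
    rewrite expr0 mulr1 (le_trans (Mh _ x01))//.
    rewrite (@le_trans _ _ (2 * a + M))// ?lerDr ?mulr_ge0//.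
    by rewrite ler_peMr ?e1// addr_ge0// mulr_ge0.
  set c := 2 * a + M * 2^-1 ^+ n in IHn.
  have c0 : 0 <= c by rewrite addr_ge0// mulr_ge0// exprn_ge0// invr_ge0.
  have -> : 2 * a + M * 2^-1 ^+ n.+1 = a + c / 2 by rewrite /c exprS; field.
  rewrite -[h x](subrK (b * kern h x)) (le_trans (ler_normD _ _))// mulrDl lerD//.
    by rewrite (le_trans (ha _ x01))// ler_peMr ?e1.
  rewrite normrM; apply: (@le_trans _ _ (`|b| * (c / w * expR (w * x)))).
    by rewrite ler_wpM2l// le_kern_exp.
  rewrite mulrA ler_wpM2r ?expR_ge0// mulrCA ler_wpM2l//.
  by rewrite ler_pdivrMr// mulrC ler_pdivlMr// /w; lra.
move=> x /[dup] x01 /andP[x0 x1].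
rewrite (@le_trans _ _ (2 * a * expR (w * x)))//; last first.
  by rewrite ler_wpM2l ?mulr_ge0// ler_expR ler_piMr// ltW.
rewrite -subr_le0; apply: (@le0_geometric _ (M * expR (w * x))) => n.
by rewrite lerBlDl (le_trans (itr n x x01))// le_eqVlt; apply/orP; left; apply/eqP; ring.
Qed.

End String.

(** * The Volterra equation: uniqueness and the Wronskian *)

Section Solutions.
Variable R : realType.
Local Notation T := (measurableTypeR R).
Local Notation I := (`[0, 1]%classic : set T).
Local Notation leb := (@lebesgue_measure R).
Variable mu : probability T R.
Implicit Types (L A B x y : R) (f g : R -> R).

(* The integrated form of d/dmu f' = - L f with f(0) = A and f'(0) = B: by
   Fubini, kern mu f is the iterated integral of f, first in mu and then in
   Lebesgue measure. The derivative f' is slope L B f. *)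
Definition solution L A B f : Prop := bounded_measurable f /\
  forall x, 0 <= x <= 1 -> f x = A + B * x - L * kern mu f x.

Definition slope L B f x : R := B - L * \int[mu]_(t in `[0, x]) f t.

Lemma solution_unique L A B f g : solution L A B f -> solution L A B g ->
  forall x, 0 <= x <= 1 -> f x = g x.
Proof.
move=> [bf fE] [bg gE] x x01; apply/eqP; rewrite -subr_eq0 -normr_le0.
have := @gronwall _ mu 0 (- L) (fun t => f t - g t) (bmB bf bg) (lexx 0).
rewrite mulr0 mul0r; apply => // y /[dup] y01 /andP[y0 y1].
rewrite kernB// {1}fE// {1}gE// normr_le0; apply/eqP; ring.
Qed.

Lemma solutionZ a L A B f : solution L A B f ->
  solution L (a * A) (a * B) (fun x => a * f x).
Proof.
move=> [bf fE]; split; first exact: bmZ.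
by move=> x /[dup] x01 /andP[x0 x1]; rewrite fE// kernZ//; ring.
Qed.

Lemma bm_slope L B f : bounded_measurable f -> bounded_measurable (slope L B f).
Proof.
move=> bf; apply: bmB; first exact: bm_cst.
by apply/bmZ/bm_primitive => //; exact: probability_fin.
Qed.

Lemma Rintegral_slope L A B f x : bounded_measurable f -> 0 <= x <= 1 ->
  \int[leb]_(t in `[0, x]) slope L B f t = B * x - L * kern mu f x.
Proof.
move=> bf x01; have /andP[x0 x1] := x01.
have bF : bounded_measurable (fun t => \int[mu]_(s in `[0, t]) f s).
  by apply: bm_primitive => //; exact: probability_fin.
have i1 (h : R -> R) : bounded_measurable h ->
    leb.-integrable (`[0, x]%classic : set T) (EFin \o h).
  by apply: bm_integrable_itv => //; exact: lebesgue01.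
rewrite RintegralB//; last 2 first.
- exact/i1/bm_cst.
- exact/i1/bmZ.
rewrite RintegralZl//; last exact: i1.
rewrite Rintegral_primitive//; last exact: probability_fin.
by rewrite Rintegral_cst_lebesgue.
Qed.

(** Green's identity in integrated form. The parameters may differ, which serves the sign analysis
    near an eigenvalue; for L = L' the integral drops out and the Wronskian is constant. *)
Lemma wronskian L L' A A' B B' f g :
  solution L A B f -> solution L' A' B' g ->
  f 1 * slope L' B' g 1 - slope L B f 1 * g 1 =
  A * B' - B * A' + (L - L') * \int[mu]_(t in `[0, 1]) (f t * g t).
Proof.
have one01 : 0 <= (1 : R) <= 1 by rewrite lexx ler01.
have prim h : bounded_measurable h ->
    bounded_measurable (fun t => \int[mu]_(s in `[0, t]) h s).
  by move=> bh; apply: bm_primitive => //; exact: probability_fin.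
have il (h : R -> R) : bounded_measurable h ->
    leb.-integrable (`[0, 1]%classic : set T) (EFin \o h).
  by apply: bm_integrable_itv => //; exact: lebesgue01.
(* The product rule for p = f1' and q = g1. Used for (f, g) and for (g, f), it yields the same
   Lebesgue integral of the product of the two [mu]-primitives, which cancels once weighted by L'
   and L. *)
have key L1 A1 B1 f1 g1 : solution L1 A1 B1 f1 -> bounded_measurable g1 ->
    f1 1 * \int[mu]_(t in `[0, 1]) g1 t = B1 * kern mu g1 1
    - L1 * \int[leb]_(t in `[0, 1]) ((\int[mu]_(s in `[0, t]) f1 s)
                                   * \int[mu]_(s in `[0, t]) g1 s)
    + \int[mu]_(t in `[0, 1]) (f1 t * g1 t).
  move=> [bf fE] bg.
  have := product_rule (@probability_fin _ mu _ (measurable_itv _))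
    (bm_slope L1 B1 bf) bg one01.
  rewrite Rintegral_slope//.
  have -> : \int[leb]_(t in `[0, 1]) (slope L1 B1 f1 t *
        \int[mu]_(s in `[0, t]) g1 s) = B1 * kern mu g1 1 -
      L1 * \int[leb]_(t in `[0, 1]) ((\int[mu]_(s in `[0, t]) f1 s)
                                   * \int[mu]_(s in `[0, t]) g1 s).
    rewrite /kern -Rintegral_primitive//; last exact: probability_fin.
    rewrite -RintegralZl//; last exact/il/prim.
    rewrite -RintegralZl//; last by apply/il/bmM; exact: prim.
    rewrite -RintegralB//; last 2 first.
    - exact/il/bmZ/prim.
    - by apply/il/bmZ/bmM; exact: prim.
    by apply: eq_Rintegral => t _; rewrite /slope; ring.
  have -> : \int[mu]_(t in `[0, 1]) (g1 t *
        \int[leb]_(s in `[0, t]) slope L1 B1 f1 s) =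
      \int[mu]_(t in `[0, 1]) (f1 t * g1 t) - A1 * \int[mu]_(t in `[0, 1]) g1 t.
    rewrite -RintegralZl//; last exact: bm_int.
    rewrite -RintegralB//; last 2 first.
    - by apply: bm_int => //; exact: bmM.
    - by apply: bm_int => //; exact: bmZ.
    apply: eq_Rintegral => t; rewrite inE/= in_itv/= => t01.
    by rewrite Rintegral_slope// (fE t t01); ring.
  have -> : f1 1 = (B1 * 1 - L1 * kern mu f1 1) + A1.
    by rewrite (fE _ one01) [RHS]addrC addrA.
  by move=> E; rewrite mulrDl E; ring.
move=> sf sg; have [bf fE] := sf; have [bg gE] := sg.
have := key _ _ _ _ _ sf bg; have := key _ _ _ _ _ sg bf.
rewrite /slope.
set X := \int[leb]_(t in `[0, 1]) _; set X' := \int[leb]_(t in `[0, 1]) _.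
have -> : X = X' by apply: eq_Rintegral => t _; rewrite mulrC.
have -> : \int[mu]_(t in `[0, 1]) (g t * f t) = \int[mu]_(t in `[0, 1]) (f t * g t).
  by apply: eq_Rintegral => t _; rewrite mulrC.
move=> E1 E2.
have := gE _ one01; have := fE _ one01; rewrite !mulr1 => f1 g1.
set F := \int[mu]_(t in `[0, 1]) f t in E1 E2 *.
set G := \int[mu]_(t in `[0, 1]) g t in E1 E2 *.
transitivity (f 1 * B' - L' * (f 1 * G) - B * g 1 + L * (g 1 * F)); first by ring.
by rewrite E1 E2 f1 g1; ring.
Qed.

End Solutions.

(** * The cosine series and its integral equation *)

Section StringCosine.
Variable R : realType.
Local Notation T := (measurableTypeR R).
Local Notation I := (`[0, 1]%classic : set T).
Local Notation leb := (@lebesgue_measure R).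
Variable mu : probability T R.
Implicit Types (L x : R) (n : nat).

Local Notation q n := (iter n (kern mu) (fun=> 1)).

Lemma bm_iter_kern n : bounded_measurable (q n).
Proof. by elim: n => [|n IHn] /=; [exact: bm_cst|exact: bm_kern]. Qed.

Lemma iter_kern_ge0 n x : 0 <= x <= 1 -> 0 <= q n x.
Proof.
elim: n x => [|n IHn] x /andP[x0 x1] /=; first exact: ler01.
exact: kern_ge0.
Qed.

(** The rate w is free, so the decay w^(-n) beats |L|^n for any given L; this does the work of a
    factorial bound. *)
Lemma le_iter_kern (w : R) n x : 0 < w -> 0 <= x <= 1 ->
  `|q n x| <= w^-1 ^+ n * expR (w * x).
Proof.
move=> w0; elim: n x => [|n IHn] x /[dup] x01 /andP[x0 x1] /=.
  by rewrite expr0 mul1r normr1 -expR0 ler_expR mulr_ge0// ltW.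
rewrite exprSr; apply: le_kern_exp => //; last exact: bm_iter_kern.
by rewrite exprn_ge0// invr_ge0 ltW.
Qed.

Lemma p_fun_even n x : 0 <= x <= 1 -> p_fun mu (2 * n) x = q n x.
Proof.
elim: n x => [//|n IHn] x x01.
rewrite mulnS !addSn add0n /= mul2n odd_double/= -mul2n.
have /andP[x0 x1] := x01.
have := Rintegral_primitive (probability_fin mu (measurable_itv _))
  (bm_iter_kern n) x01.
apply: etrans.
apply: eq_Rintegral => t; rewrite inE/= in_itv/= => /andP[t0 tx].
apply: eq_Rintegral => s; rewrite inE/= in_itv/= => /andP[s0 st].
by rewrite IHn// s0 (le_trans st (le_trans tx x1)).
Qed.

(* x |-> c_{lambda,mu}(z, x) as a function of L = z^2, for all real L. *)
Definition string_cos_term L x n : R := (- L) ^+ n * q n x.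

Definition string_cos L x : R := limn (series (string_cos_term L x)).

Lemma c_fun_string_cos L x : 0 <= L -> 0 <= x <= 1 ->
  c_fun mu (Num.sqrt L) x = string_cos L x.
Proof.
move=> L0 x01; rewrite /c_fun /string_cos; congr (limn (series _)).
apply/funext => n; rewrite p_fun_even// /string_cos_term exprM sqr_sqrtr//.
by rewrite -exprMn mulN1r.
Qed.

(** As in [gronwall], |L| / w < 1/2, so that the cosine series is dominated by a multiple of
    2^(-n). *)
Let w L := 2 * `|L| + 1.

Lemma le_string_cos_term L x n : 0 <= x <= 1 ->
  `|string_cos_term L x n| <= expR (w L) * 2^-1 ^+ n.
Proof.
move=> /[dup] x01 /andP[x0 x1].
have w0 : 0 < w L by rewrite ltr_wpDl// mulr_ge0.
rewrite normrM normrX normrN.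
apply: (@le_trans _ _ (`|L| ^+ n * ((w L)^-1 ^+ n * expR (w L * x)))).
  by rewrite ler_wpM2l ?exprn_ge0// le_iter_kern.
rewrite mulrA -exprMn mulrC ler_pM ?expR_ge0 ?exprn_ge0 ?divr_ge0 ?(ltW w0)//.
  by rewrite ler_expR ler_piMr// ltW.
rewrite lerXn2r ?nnegrE ?divr_ge0 ?(ltW w0) ?invr_ge0//.
rewrite ler_pdivrMr// mulrC ler_pdivlMr//.
by rewrite /w; lra.
Qed.

Lemma is_cvg_string_cos L x : 0 <= x <= 1 ->
  cvgn (series (string_cos_term L x)).
Proof.
move=> x01; apply: normed_cvg.
apply: (@series_le_cvg _ _ (geometric (expR (w L)) 2^-1)) => //.
- by move=> n; exact: normr_ge0.
- by move=> n; rewrite /= mulr_ge0 ?expR_ge0// exprn_ge0 ?invr_ge0.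
- by move=> n; exact: le_string_cos_term.
apply: is_cvg_geometric_series.
by rewrite ger0_norm ?invr_ge0// invf_lt1// ltr1n.
Qed.

Lemma string_cos_tail L x n : 0 <= x <= 1 ->
  `|string_cos L x - series (string_cos_term L x) n|
    <= 2 * expR (w L) * 2^-1 ^+ n.
Proof.
move=> x01; set s := series _.
(* The geometric sum in closed form: it gives the factor 2 and a bound uniform in k, ready for the
   limit. *)
have partial k : `|s (n + k)%N - s n| <=
    2 * expR (w L) * (2^-1 ^+ n - 2^-1 ^+ (n + k)).
  elim: k => [|k IHk]; first by rewrite addn0 !subrr normr0 mulr0.
  have -> : s (n + k.+1)%N - s n = (s (n + k)%N - s n) +
      string_cos_term L x (n + k)%N.
    by rewrite /s addnS seriesSr addrAC.
  rewrite (le_trans (ler_normD _ _))//.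
  rewrite (le_trans (lerD IHk (le_string_cos_term _ _ x01)))//.
  rewrite addnS exprS le_eqVlt; apply/orP; left; apply/eqP; by field.
have lim : (fun k => `|s (n + k)%N - s n|) @ \oo --> `|string_cos L x - s n|.
  apply: cvg_norm; apply: cvgB; last exact: cvg_cst.
  rewrite (_ : (fun k => s (n + k)%N) = (fun k => s (k + n)%N)); last first.
    by apply/funext => j; rewrite addnC.
  by rewrite cvg_shiftn; exact: is_cvg_string_cos.
have -> : `|string_cos L x - s n| = limn (fun k => `|s (n + k)%N - s n|).
  by apply/esym/(cvg_lim _ lim).
apply: limr_le; first exact: cvgP lim.
apply: nearW => k; rewrite (le_trans (partial k))//.
rewrite ler_wpM2l ?mulr_ge0 ?expR_ge0// gerBl.
by rewrite exprn_ge0// invr_ge0.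
Qed.

Lemma bm_string_cos_series L n :
  bounded_measurable (fun x => series (string_cos_term L x) n).
Proof.
elim: n => [|n IHn].
  by apply: eq_bm (bm_cst 0) => x _; rewrite /series/= big_geq.
apply: (eq_bm _ (bmD IHn (bmZ ((- L) ^+ n) (bm_iter_kern n)))) => x _.
by rewrite seriesSr.
Qed.

Lemma bm_string_cos L : bounded_measurable (string_cos L).
Proof.
split.
  apply: (@measurable_fun_cvg _ T R I
    (fun n x => series (string_cos_term L x) n)).
    by move=> n; have [] := bm_string_cos_series L n.
  by move=> x; rewrite /= in_itv/=; exact: is_cvg_string_cos.
exists (2 * expR (w L)) => x x01.
by have := string_cos_tail L 0 x01; rewrite /series/= big_geq// subr0 expr0 mulr1.
Qed.

(** The partial sums are the Picard iterates of f = 1 - L [kern] f, started at the empty sum 0. *)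
Lemma string_cos_seriesS L n x : 0 <= x <= 1 ->
  series (string_cos_term L x) n.+1 =
  1 - L * kern mu (fun t => series (string_cos_term L t) n) x.
Proof.
move=> /andP[x0 x1]; elim: n => [|n IHn].
  rewrite /series/= big_nat1 /string_cos_term expr0 mul1r/=.
  rewrite (@eq_kern _ _ _ (fun=> 0 * 1))//; last first.
    by move=> t _; rewrite big_geq// mul0r.
  by rewrite kernZ ?mul0r ?mulr0 ?subr0//; exact: bm_cst.
rewrite seriesSr IHn.
have -> : kern mu (fun t => series (string_cos_term L t) n.+1) x =
    kern mu (fun t => series (string_cos_term L t) n) x + (- L) ^+ n * q n.+1 x.
  rewrite /= -kernZ//; last exact: bm_iter_kern.
  rewrite -kernD//; last 2 first.
  - exact: bm_string_cos_series.
  - exact/bmZ/bm_iter_kern.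
  by apply: eq_kern => // t _; rewrite seriesSr.
by rewrite /string_cos_term exprS; ring.
Qed.

Lemma string_cos_solution L : solution mu L 1 0 (string_cos L).
Proof.
split; first exact: bm_string_cos.
move=> x /[dup] x01 /andP[x0 x1].
apply/eqP; rewrite mul0r addr0 -subr_eq0 -normr_le0.
(* By the Picard relation the defect is the tail after n + 1 terms plus L [kern] of the tail after n
   terms. The tail bound is uniform in x, so it passes through [kern]. *)
apply: (@le0_geometric _ ((1 + `|L|) * (2 * expR (w L)))) => n.
set s := series (string_cos_term L x).
have -> : string_cos L x - (1 - L * kern mu (string_cos L) x) =
    (string_cos L x - s n.+1) +
    L * kern mu (fun t => string_cos L t - series (string_cos_term L t) n) x.
  rewrite /s string_cos_seriesS// kernB//.
  - by ring.
  - exact: bm_string_cos.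
  - exact: bm_string_cos_series.
rewrite (le_trans (ler_normD _ _))// -mulrA mulrDl mul1r lerD//.
  rewrite (le_trans (string_cos_tail L n.+1 x01))//.
  rewrite ler_wpM2l ?mulr_ge0 ?expR_ge0// exprS ler_piMl//.
  by rewrite invf_le1// ler1n.
rewrite normrM ler_wpM2l//; apply: le_kern_cst => //.
  by apply: bmB; [exact: bm_string_cos|exact: bm_string_cos_series].
by move=> t t01; exact: string_cos_tail.
Qed.

Lemma string_cos_ge1 L x : L <= 0 -> 0 <= x <= 1 -> 1 <= string_cos L x.
Proof.
move=> L0 x01; apply: limr_ge; first exact: is_cvg_string_cos.
exists 1%N => // n /= n1.
rewrite /series/= big_ltn// {1}/string_cos_term expr0 mul1r lerDl.
apply: sumr_ge0 => i _; rewrite mulr_ge0 ?iter_kern_ge0//.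
by rewrite exprn_ge0// oppr_ge0.
Qed.

End StringCosine.

(** * Neumann eigenvalues as zeros of the end slope *)

Section NeumannEigenvalues.
Variable R : realType.
Local Notation T := (measurableTypeR R).
Local Notation I := (`[0, 1]%classic : set T).
Local Notation leb := (@lebesgue_measure R).
Variable mu : probability T R.
Implicit Types (L x : R).

(** From |h| <= 1 + h^2, h is integrable for the probability [mu]. An eigenfunction is given with
    square-integrability only, and this begins its bootstrap to boundedness. *)
Lemma square_integrable_primitive_bounded (h : R -> R) : measurable_fun I h ->
  mu.-integrable I (fun x => ((h x) ^+ 2)%:E) ->
  exists M : R, forall x, 0 <= x <= 1 ->
    `|\int[mu]_(t in `[0, x]) h t| <= M.
Proof.
move=> mh h2.
have h1 : mu.-integrable I (EFin \o h).
  apply: (@le_integrable _ _ _ mu I _ _ (fun x => 1%:E + ((h x) ^+ 2)%:E)%E) => //.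
  - exact/measurable_EFinP.
  - move=> x _; rewrite -EFinD !abse_EFin lee_fin [leRHS]ger0_norm.
      rewrite -[h x ^+ 2]real_normK ?num_real//.
      have := sqr_ge0 (`|h x| - 1); have := normr_ge0 (h x); nra.
    by rewrite addr_ge0// sqr_ge0.
  - apply: integrableD => //; apply: (bm_integrable _ _ _ (bm_cst 1)) => //.
    exact: probability_fin.
exists (\int[mu]_(t in I) `|h t|) => x /andP[x0 x1].
have mx : measurable (`[0, x]%classic : set T) by exact: measurable_itv.
have hx : mu.-integrable (`[0, x]%classic : set T) (EFin \o h).
  by apply: integrableS h1 => //; exact: sub_itv01.
rewrite (le_trans (le_normr_Rintegral mx hx))//.
have finite (D : set T) : measurable D -> mu.-integrable D (EFin \o h) ->
    (\int[mu]_(t in D) `|h t|%:E)%E \is a fin_num.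
  move=> mD hD; apply: integrable_fin_num => //.
  exact: (integrable_abse hD).
rewrite fine_le ?finite//; apply: ge0_subset_integral => //; last exact: sub_itv01.
by apply/measurable_EFinP; exact: measurableT_comp.
Qed.

(** The interval is closed, so a mass at 0 counts. In [kern] the factor x - t kills it; for the
    initial slope it is removed by [mu [set 0] = 0]. *)
Lemma Rintegral_itv00 (f : R -> R) :
  \int[mu]_(t in `[0, 0]) f t = f 0 * fine (mu [set 0]).
Proof.
rewrite -[in RHS]set_itv1 -Rintegral_cst//; apply: eq_Rintegral => t.
by rewrite inE/= in_itv/= => /le_anti <-.
Qed.

Lemma solution_eq_string_cos L A f : solution mu L A 0 f ->
  forall x, 0 <= x <= 1 -> f x = A * string_cos mu L x.
Proof.
move=> sf; have := solutionZ A (string_cos_solution mu L); rewrite mulr1 mulr0.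
exact: solution_unique sf.
Qed.

Lemma solution0 L A B f : solution mu L A B f -> f 0 = A.
Proof.
move=> [_ ->]; last by rewrite lexx ler01.
rewrite mulr0 addr0 (_ : kern mu f 0 = 0) ?mulr0 ?subr0//.
by rewrite /kern Rintegral_itv00 subrr !mul0r.
Qed.

(** The characteristic function of the Neumann problem: for L = z^2 it equals -z times the sine
    series sin_mu^N(z). *)
Definition end_slope L : R := slope mu L 0 (string_cos mu L) 1.

Lemma slopeZ a L f x : x <= 1 -> bounded_measurable f ->
  slope mu L 0 (fun t => a * f t) x = a * slope mu L 0 f x.
Proof.
by move=> x1 bf; rewrite /slope RintegralZl//; [ring|exact: bm_int].
Qed.

Lemma eq_slope L B f g x : x <= 1 -> (forall t, 0 <= t <= 1 -> f t = g t) ->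
  slope mu L B f x = slope mu L B g x.
Proof.
move=> x1 fg; congr (_ - _ * _); apply: eq_Rintegral => t.
rewrite inE/= in_itv/= => /andP[t0 tx].
by rewrite fg// t0 (le_trans tx).
Qed.

Lemma neumann_eigenvalueP L : mu [set 0] = 0%E ->
  neumann_eigenvalue mu L <-> end_slope L = 0.
Proof.
move=> mu0; split; last first.
  move=> sL0; have sC := string_cos_solution mu L; have [bC CE] := sC.
  have s0 : slope mu L 0 (string_cos mu L) 0 = 0.
    by rewrite /slope Rintegral_itv00 mu0 !mulr0 subr0.
  exists (string_cos mu L), (slope mu L 0 (string_cos mu L)); split => //.
  - exists 0; first by rewrite lexx ler01.
    by rewrite (solution0 sC) oner_neq0.
  - have bs := bm_slope mu L 0 bC; split; first by case: bs.
      by apply: bm_integrable => //; [exact: lebesgue01|exact: bmM].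
    move=> x x01; rewrite Rintegral_slope// (solution0 sC) {1}CE//.
    by rewrite addrA.
  - have bs := bmZ (- L) bC; split; first by case: bs.
      by apply: bm_integrable => //; [exact: probability_fin|exact: bmM].
    move=> x /andP[x0 x1]; rewrite s0 RintegralZl//; last exact: bm_int.
    by rewrite /slope sub0r add0r mulNr.
(* For L = 0 the conditions on -L f say nothing about f, but then the end slope is trivially 0. *)
have [->|L0] := eqVneq L 0; first by rewrite /end_slope /slope mul0r subr0.
move=> [f [g [[y y01 fy0] [mg g2 fE] [mLf Lf2 gE] g0 g1]]].
have gs x : 0 <= x <= 1 -> g x = \int[mu]_(t in `[0, x]) (- L * f t).
  by move=> x01; rewrite gE// g0 add0r.
(* Bootstrap: f is a multiple of the measurable -L f; g is bounded as a primitive of a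
   square-integrable function; hence f, a Lebesgue primitive of g, is bounded. *)
have bf : bounded_measurable f.
  split.
    have -> : f = (fun x => (- L)^-1 * (- L * f x)).
      by apply/funext => x; rewrite mulrA mulVf ?mul1r// oppr_eq0.
    by apply: measurable_funM.
  have [M MP] := square_integrable_primitive_bounded mLf Lf2.
  have bg : bounded_measurable g.
    by split => //; exists M => x x01; rewrite gs// MP.
  have [_ [N NP]] := bm_primitive (lebesgue01 R) bg.
  exists (`|f 0| + N) => x x01; rewrite fE// (le_trans (ler_normD _ _))//.
  by rewrite lerD2l NP.
have sf : solution mu L (f 0) 0 f.
  split=> // x x01; rewrite {1}fE// -addrA; congr (_ + _).
  rewrite -Rintegral_slope//; apply: eq_Rintegral => t.
  have /andP[x0 x1] := x01.
  rewrite inE/= in_itv/= => /andP[t0 tx].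
  have t1 := le_trans tx x1.
  rewrite gs ?t0// RintegralZl//; last exact: bm_int.
  by rewrite /slope sub0r mulNr.
have fC := solution_eq_string_cos sf.
(* By uniqueness f = f(0) C, so f(0) = 0 would make f vanish; dividing g(1) = f(0) [end_slope L] = 0
   by f(0) concludes. *)
have f00 : f 0 != 0.
  by apply: contraNneq fy0 => f0; rewrite fC// f0 mul0r.
apply/eqP; rewrite -(mulrI_eq0 _ (mulfI f00)); apply/eqP.
rewrite -slopeZ//; last by have [] := string_cos_solution mu L.
rewrite -(@eq_slope _ _ f)// /slope sub0r -mulNr -RintegralZl//; last exact: bm_int.
by rewrite -gs// lexx ler01.
Qed.

(** For L < 0 all terms of the cosine series are nonnegative and the first is 1, so C >= 1. This
    rules out negative eigenvalues. *)
Lemma end_slope_gt0 L : mu I = 1%E -> L < 0 -> 0 < end_slope L.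
Proof.
move=> mu1 L0; rewrite /end_slope /slope sub0r -mulNr.
rewrite mulr_gt0 ?oppr_gt0//.
rewrite (@lt_le_trans _ _ (\int[mu]_(t in I) (1 : R)))//.
  by rewrite Rintegral_cst// mul1r (congr1 fine mu1) ltr01.
apply: le_Rintegral => //.
- by apply: bm_int => //; exact: bm_cst.
- by apply: bm_int => //; exact: bm_string_cos.
- by move=> x; rewrite /= in_itv/= => x01; exact: string_cos_ge1 (ltW L0) x01.
Qed.

End NeumannEigenvalues.

(** * Integration against the self-similar measure *)

Section SelfSimilar.
Variable R : realType.
Local Notation T := (measurableTypeR R).
Local Notation I := (`[0, 1]%classic : set T).
Variables (r1 r2 m1 m2 : R) (mu : probability T R).
Hypotheses (r1_gt0 : 0 < r1) (r2_gt0 : 0 < r2) (m1_gt0 : 0 < m1) (m2_gt0 : 0 < m2).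
Hypotheses (r_le1 : r1 + r2 <= 1) (m_eq1 : m1 + m2 = 1).
Hypothesis mu_ss : self_similar_measure r1 r2 m1 m2 mu.

Local Notation S1 := (fun x : R => r1 * x).
Local Notation S2 := (fun x : R => r2 * x + 1 - r2).

Let muI : mu I = 1%E. Proof. by case: mu_ss. Qed.

Let mS1 : measurable_fun (setT : set T) (S1 : T -> T).
Proof. exact: measurable_funM. Qed.

Let mS2 : measurable_fun (setT : set T) (S2 : T -> T).
Proof.
by apply: measurable_funB => //; apply: measurable_funD => //; exact: measurable_funM.
Qed.

Let mpre (S : T -> T) (D : set T) : measurable_fun setT S -> measurable D ->
  measurable (S @^-1` D).
Proof. by move=> mS mD; rewrite -[_ @^-1` _]setTI; exact: mS. Qed.

Let probability_setC01 : mu (~` I) = 0%E.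
Proof. exact: probability_setC0. Qed.

Let probability_setI01 (A : set T) : measurable A -> mu (A `&` I) = mu A.
Proof.
move=> mA; apply/eqP; rewrite eq_le le_measure ?inE//=; last exact: measurableI.
rewrite -{1}(setIT A) -(setUv I) setIUr (le_trans (measureU2 _ _ _))//.
- exact: measurableI.
- by apply: measurableI => //; exact: measurableC.
rewrite -[leRHS]adde0 leeD2l//.
rewrite -probability_setC01 le_measure ?inE//.
- by apply: measurableI => //; exact: measurableC.
- exact: measurableC.
Qed.

(** The point 0 is fixed by S1 and missed by S2 on [0, 1], so its mass satisfies p = m1 p, while 1 -
    m1 = m2 > 0. *)
Lemma self_similar_set1 : mu [set 0] = 0%E.
Proof.
have [_ ss] := mu_ss.
have m0 : measurable ([set 0] : set T) by exact: measurable_set1.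
have S20 : mu (S2 @^-1` [set 0]) = 0%E.
  rewrite -probability_setI01; last exact: mpre.
  rewrite (_ : _ `&` _ = set0) ?measure0//.
  apply/seteqP; split => // x /= [] E; rewrite in_itv/= => /andP[x0 x1].
  have r2x : 0 <= r2 * (x : R) by rewrite mulr_ge0// ltW.
  suff : 0 < r2 * (x : R) + 1 - r2 by rewrite E ltxx.
  by rewrite -addrA ltr_wpDl// subr_gt0 (lt_le_trans _ r_le1)// ltrDr.
have := ss [set 0] m0.
rewrite S20 mule0 adde0 (_ : S1 @^-1` [set 0] = [set 0]); last first.
  apply/seteqP; split => x /= E; last by rewrite E mulr0.
  by apply/eqP; move/eqP : E; rewrite mulf_eq0 gt_eqF.
have sub0 : [set 0] `<=` I by move=> x /= ->; rewrite in_itv/= lexx ler01.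
move=> /(_ sub0).
rewrite -(@fineK _ (mu [set 0])) ?fin_num_measure//.
move=> /eqP; rewrite -EFinM eqe -subr_eq0 -{1}[fine _]mul1r -mulrBl mulf_eq0.
rewrite -m_eq1 addrAC subrr add0r gt_eqF//= => /eqP -> //.
Qed.

(** On subsets of D, [mu] is the weighted sum of its two pushforwards. The preimages may stick out
    of [0, 1] and are cut back to [I], which carries [mu]. *)
Lemma ge0_integral_self_similar (D : set T) (f : R -> \bar R) : measurable D ->
  D `<=` I -> measurable_fun D f -> (forall x, D x -> 0 <= f x)%E ->
  (\int[mu]_(x in D) f x =
     m1%:E * \int[mu]_(x in (S1 @^-1` D) `&` I) f (r1 * x)%R +
     m2%:E * \int[mu]_(x in (S2 @^-1` D) `&` I) f (r2 * x + 1 - r2)%R)%E.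
Proof.
move=> mD DI mf f0.
pose k1 : {nonneg R} := NngNum (ltW m1_gt0).
pose k2 : {nonneg R} := NngNum (ltW m2_gt0).
pose P1 := measure_function_pushforward__canonical__measure_function_Measure mu mS1.
pose P2 := measure_function_pushforward__canonical__measure_function_Measure mu mS2.
rewrite (@eq_measure_integral _ _ _ _
  (measure_add (mscale k1 P1) (mscale k2 P2))); last first.
  move=> A mA AD; have [_ ss] := mu_ss.
  apply: etrans (esym (measure_addE _ _ _)); apply: ss => // x /AD.
  exact: DI.
have restr (S : T -> T) : measurable_fun setT S ->
    (\int[mu]_(x in S @^-1` D) (f \o S) x =
     \int[mu]_(x in (S @^-1` D) `&` I) (f \o S) x)%E.
  move=> mS; rewrite (@ge0_negligible_integral _ _ _ mu _ (~` I)).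
  - by rewrite setDE setCK.
  - exact: measurableC.
  - exact: mpre.
  - by apply: (@measurable_comp _ _ _ T T _ D) => //;
      [move=> _ [x + <-]|exact: measurable_funTS].
  - by move=> x /f0.
  - exact: probability_setC01.
rewrite ge0_integral_measure_add// !ge0_integral_mscale//.
rewrite !ge0_integral_pushforward//; last 2 first.
- by move=> x; rewrite inE; exact: f0.
- by move=> x; rewrite inE; exact: f0.
by rewrite !restr.
Qed.

Lemma S1_itv01 (x : R) : 0 <= x <= 1 -> 0 <= r1 * x <= 1.
Proof.
move=> /andP[x0 x1]; rewrite mulr_ge0 ?(ltW r1_gt0)//=.
have := ler_piMr (ltW r1_gt0) x1; have := r2_gt0; have := r_le1; lra.
Qed.

Lemma S2_itv01 (x : R) : 0 <= x <= 1 -> 0 <= r2 * x + 1 - r2 <= 1.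
Proof.
move=> /andP[x0 x1]; have := ler_piMr (ltW r2_gt0) x1.
have := mulr_ge0 (ltW r2_gt0) x0; have := r1_gt0; have := r_le1.
by move=> *; apply/andP; split; lra.
Qed.

Lemma bm_comp_S1 (f : R -> R) : bounded_measurable f ->
  bounded_measurable (fun x => f (r1 * x)).
Proof.
move=> bf; apply: (@eq_bm _ (fun x => f (r1 * x + 0))).
  by move=> x _; rewrite addr0.
by apply: bm_comp_affine bf => x /S1_itv01; rewrite addr0.
Qed.

Lemma bm_comp_S2 (f : R -> R) : bounded_measurable f ->
  bounded_measurable (fun x => f (r2 * x + 1 - r2)).
Proof.
move=> bf; apply: (@eq_bm _ (fun x => f (r2 * x + (1 - r2)))).
  by move=> x _; rewrite addrA.
by apply: bm_comp_affine bf => x /S2_itv01; rewrite addrA.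
Qed.

(** A bound M of |f| reduces the signed case to the nonnegative functions f + M and M, whose
    identities are subtracted. *)
Lemma Rintegral_self_similar (D : set T) (f : R -> R) : measurable D ->
  D `<=` I -> bounded_measurable f ->
  \int[mu]_(x in D) f x =
     m1 * \int[mu]_(x in (S1 @^-1` D) `&` I) f (r1 * x) +
     m2 * \int[mu]_(x in (S2 @^-1` D) `&` I) f (r2 * x + 1 - r2).
Proof.
have ge0 (D' : set T) (g : R -> R) : measurable D' -> D' `<=` I ->
    bounded_measurable g -> (forall x, 0 <= x <= 1 -> 0 <= g x) ->
    \int[mu]_(x in D') g x =
     m1 * \int[mu]_(x in (S1 @^-1` D') `&` I) g (r1 * x) +
     m2 * \int[mu]_(x in (S2 @^-1` D') `&` I) g (r2 * x + 1 - r2).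
  move=> mD DI bg g0; rewrite /Rintegral ge0_integral_self_similar//; last 2 first.
  - by apply/measurable_EFinP; apply: measurable_funS bg.1.
  - by move=> x /DI; rewrite /= in_itv/= => /g0; rewrite lee_fin.
  have mD1 : measurable ((S1 @^-1` D') `&` I).
    by apply: measurableI => //; exact: mpre.
  have mD2 : measurable ((S2 @^-1` D') `&` I).
    by apply: measurableI => //; exact: mpre.
  have fin (E : set T) (h : R -> R) : measurable E -> E `<=` I ->
      bounded_measurable h -> (\int[mu]_(x in E) (h x)%:E)%E \is a fin_num.
    move=> mE EI bh; apply: integrable_fin_num => //.
    by apply: bm_integrable => //; exact: probability_fin.
  have f1 := fin _ _ mD1 (@subIsetr _ _ _) (bm_comp_S1 bg).
  have f2 := fin _ _ mD2 (@subIsetr _ _ _) (bm_comp_S2 bg).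
  by rewrite fineD ?fin_numM// !fineM.
move=> mD DI bf; have [_ [M fM]] := bf.
have cst0 (x : R) : 0 <= x <= 1 -> 0 <= M.
  by move=> x01; rewrite (le_trans _ (fM _ x01)).
have sh0 (x : R) : 0 <= x <= 1 -> 0 <= f x + M.
  by move=> x01; have := fM _ x01; rewrite ler_norml => /andP[]; lra.
have add (E : set T) (g h : R -> R) : measurable E -> E `<=` I ->
    bounded_measurable g -> bounded_measurable h ->
    \int[mu]_(x in E) (g x + h x) =
    \int[mu]_(x in E) g x + \int[mu]_(x in E) h x.
  move=> mE EI bg bh; rewrite RintegralD//.
  - by apply: bm_integrable => //; exact: probability_fin.
  - by apply: bm_integrable => //; exact: probability_fin.
have mD1 : measurable ((S1 @^-1` D) `&` I) by apply: measurableI => //; exact: mpre.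
have mD2 : measurable ((S2 @^-1` D) `&` I) by apply: measurableI => //; exact: mpre.
have E := ge0 D _ mD DI (bmD bf (bm_cst M)) sh0.
have Ec := ge0 D _ mD DI (bm_cst M) cst0.
rewrite (add _ _ _ mD DI bf (bm_cst M)) in E.
rewrite (add _ _ _ mD1 (@subIsetr _ _ _) (bm_comp_S1 bf) (bm_cst M)) in E.
rewrite (add _ _ _ mD2 (@subIsetr _ _ _) (bm_comp_S2 bf) (bm_cst M)) in E.
by rewrite Ec in E; lra.
Qed.

Let Rintegral_sub_set1 (D : set T) (f : R -> R) : D `<=` [set 0] ->
  \int[mu]_(x in D) f x = 0.
Proof.
move=> D0; have [->|->] := subset_set1 D0; first exact: Rintegral_set0.
by rewrite -set_itv1 Rintegral_itv00 self_similar_set1 mulr0.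
Qed.

(** S2 maps [0, 1] to the right of 1 - r2 and reaches 1 - r2 only from t = 0, a null point. *)
Let preimage_S2_sub (x : R) : x <= 1 - r2 ->
  (S2 @^-1` (`[0, x]%classic : set T)) `&` I `<=` [set 0].
Proof.
move=> xr t [] /=; rewrite !in_itv/= => /andP[_ tx] /andP[t0 _].
apply/eqP; rewrite eq_le t0 andbT -(pmulr_rle0 _ r2_gt0).
by have := le_trans tx xr; rewrite -addrA gerDr.
Qed.

Let preimage_S1_sup (x : R) : r1 <= x ->
  (S1 @^-1` (`[0, x]%classic : set T)) `&` I = I.
Proof.
move=> rx; apply/setIidr => t /=; rewrite !in_itv/= => /andP[t0 t1].
rewrite mulr_ge0 ?(ltW r1_gt0)//= (le_trans _ rx)//.
by rewrite ler_piMr// ltW.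
Qed.

Lemma Rintegral_self_similar_S1 (y : R) (f : R -> R) : 0 <= y <= 1 ->
  bounded_measurable f ->
  \int[mu]_(t in `[0, r1 * y]) f t = m1 * \int[mu]_(t in `[0, y]) f (r1 * t).
Proof.
move=> y01 bf; have /andP[y0 y1] := y01; have /andP[_ ry1] := S1_itv01 y01.
rewrite Rintegral_self_similar//; last exact: sub_itv01.
rewrite [X in _ + m2 * X]Rintegral_sub_set1 ?mulr0 ?addr0; last first.
  apply: preimage_S2_sub; rewrite (@le_trans _ _ r1)// ?lerBrDr//.
  by rewrite ler_piMr// ltW.
congr (_ * Rintegral _ _ _); apply/seteqP; split => t /=.
  by rewrite !in_itv/= => -[/andP[_]]; rewrite ler_pM2l// => -> /andP[->].
rewrite !in_itv/= => /andP[t0 ty]; rewrite t0 (le_trans ty y1) ler_pM2l// ty.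
by rewrite mulr_ge0// ltW.
Qed.

Lemma Rintegral_self_similar_gap (x : R) (f : R -> R) : r1 <= x -> x <= 1 - r2 ->
  bounded_measurable f ->
  \int[mu]_(t in `[0, x]) f t = m1 * \int[mu]_(t in I) f (r1 * t).
Proof.
move=> rx xr bf; rewrite Rintegral_self_similar//; last first.
  by apply: sub_itv01; rewrite (le_trans xr)// gerBl ltW.
rewrite [X in _ + m2 * X]Rintegral_sub_set1 ?mulr0 ?addr0; last first.
  exact: preimage_S2_sub.
by rewrite preimage_S1_sup.
Qed.

Lemma Rintegral_self_similar_S2 (y : R) (f : R -> R) : 0 <= y <= 1 ->
  bounded_measurable f ->
  \int[mu]_(t in `[0, r2 * y + 1 - r2]) f t =
  m1 * \int[mu]_(t in I) f (r1 * t) +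
  m2 * \int[mu]_(t in `[0, y]) f (r2 * t + 1 - r2).
Proof.
move=> y01 bf; have /andP[y0 y1] := y01; have /andP[ry0 ry1] := S2_itv01 y01.
have r2y : 0 <= r2 * y by rewrite mulr_ge0// ltW.
rewrite Rintegral_self_similar//; last exact: sub_itv01.
rewrite preimage_S1_sup; last by have := r_le1; lra.
congr (_ + _ * Rintegral _ _ _); apply/seteqP; split => t /=.
  rewrite !in_itv/= => -[/andP[_]]; rewrite !lerD2r ler_pM2l// => -> /andP[->].
  by [].
rewrite !in_itv/= => /andP[t0 ty].
have t01 : 0 <= (t : R) <= 1 by rewrite t0 (le_trans ty y1).
have /andP[-> _] := S2_itv01 t01.
by rewrite !lerD2r ler_pM2l// ty.
Qed.

End SelfSimilar.

(** * Renormalization of the cosine on the two copies and the gap *)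

Section Renormalization.
Variable R : realType.
Local Notation T := (measurableTypeR R).
Local Notation I := (`[0, 1]%classic : set T).
Variables (r1 r2 m1 m2 : R) (mu : probability T R).
Hypotheses (r1_gt0 : 0 < r1) (r2_gt0 : 0 < r2) (m1_gt0 : 0 < m1) (m2_gt0 : 0 < m2).
Hypotheses (r_le1 : r1 + r2 <= 1) (m_eq1 : m1 + m2 = 1) (rm : r1 * m1 = r2 * m2).
Hypothesis mu_ss : self_similar_measure r1 r2 m1 m2 mu.

Variable L : R.
Let L' := r1 * m1 * L.
Local Notation C := (string_cos mu L).
Local Notation C' := (string_cos mu L').

Let S1_01 := @S1_itv01 R r1 r2 r1_gt0 r2_gt0 r_le1.
Let S2_01 := @S2_itv01 R r1 r2 r1_gt0 r2_gt0 r_le1.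
Let bm_S1 := @bm_comp_S1 R r1 r2 r1_gt0 r2_gt0 r_le1.
Let bm_S2 := @bm_comp_S2 R r1 r2 r1_gt0 r2_gt0 r_le1.
Let int_S1 := @Rintegral_self_similar_S1 R r1 r2 m1 m2 mu
  r1_gt0 r2_gt0 m1_gt0 m2_gt0 r_le1 m_eq1 mu_ss.
Let int_gap := @Rintegral_self_similar_gap R r1 r2 m1 m2 mu
  r1_gt0 r2_gt0 m1_gt0 m2_gt0 r_le1 m_eq1 mu_ss.
Let int_S2 := @Rintegral_self_similar_S2 R r1 r2 m1 m2 mu
  r1_gt0 r2_gt0 m1_gt0 m2_gt0 r_le1 mu_ss.

Let bC : bounded_measurable C. Proof. exact: bm_string_cos. Qed.
Let bC' : bounded_measurable C'. Proof. exact: bm_string_cos. Qed.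
Let one01 : 0 <= (1 : R) <= 1. Proof. by rewrite lexx ler01. Qed.
Let CE (x : R) : 0 <= x <= 1 -> C x = 1 - L * kern mu C x.
Proof. by have [_ E] := string_cos_solution mu L => /E; rewrite mul0r addr0. Qed.

(** Uniqueness for the parameter L' = r1 m1 L: rescaling the kernel x - t gives r1, rescaling the
    measure gives m1. *)
Lemma string_cos_S1 (y : R) : 0 <= y <= 1 -> C (r1 * y) = C' y.
Proof.
move: y; apply: (@solution_unique _ mu L' 1 0 (fun y => C (r1 * y)) C'); last first.
  exact: string_cos_solution.
split; first exact: bm_S1 bC.
move=> y y01; have /andP[y0 y1] := y01.
have bF : bounded_measurable (fun t => C (r1 * t)) by exact: bm_S1 bC.
rewrite CE; last exact: S1_01 y01.
rewrite /kern int_S1//; last first.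
  exact: bm_kern_integrand.
have -> : \int[mu]_(t in `[0, y]) ((r1 * y - r1 * t) * C (r1 * t)) =
    r1 * \int[mu]_(t in `[0, y]) ((y - t) * C (r1 * t)).
  rewrite -RintegralZl//; last by apply: bm_int => //; exact: bm_kern_integrand.
  by apply: eq_Rintegral => t _; rewrite mulrA mulrBr.
by rewrite /L'; ring.
Qed.

(** The effect of the mass on S1([0, 1]) at points to its right: splitting x - r1 t = (x - r1) + r1
    (1 - t) leaves the end value and the end slope of the small copy, continued linearly. *)
Let first_piece (x : R) :
  1 - L * (m1 * \int[mu]_(t in I) ((x - r1 * t) * C (r1 * t))) =
  C' 1 + (x - r1) / r1 * end_slope mu L'.
Proof.
have -> : \int[mu]_(t in I) ((x - r1 * t) * C (r1 * t)) =
    \int[mu]_(t in I) ((x - r1) * C' t + r1 * ((1 - t) * C' t)).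
  apply: eq_Rintegral => t; rewrite inE/= in_itv/= => t01.
  by rewrite string_cos_S1//; ring.
rewrite RintegralD//; last 2 first.
- by apply: bm_int => //; exact: bmZ.
- by apply: bm_int => //; apply/bmZ; exact: bm_kern_integrand.
rewrite !RintegralZl//; last 2 first.
- by apply: bm_int => //; exact: bm_kern_integrand.
- exact: bm_int.
have [_ /(_ 1 one01)] := string_cos_solution mu L'; rewrite mul0r addr0 => ->.
rewrite /end_slope /slope /kern /L'; field.
by rewrite gt_eqF.
Qed.

Lemma string_cos_gap (x : R) : r1 <= x -> x <= 1 - r2 ->
  C x = C' 1 + (x - r1) / r1 * end_slope mu L'.
Proof.
move=> rx xr; rewrite CE; last first.
  by rewrite (le_trans (ltW r1_gt0) rx) (le_trans xr)// gerBl ltW.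
rewrite -first_piece /kern int_gap//.
exact: bm_kern_integrand.
Qed.

Let F (y : R) : R := C (r2 * y + 1 - r2).

Let bF : bounded_measurable F. Proof. exact: bm_S2 bC. Qed.

(** On the gap the slope is [end_slope mu L' / r1], and the substitution S2 multiplies it by r2. The
    new parameter r2 m2 L is L' because r1 m1 = r2 m2. *)
Lemma string_cos_S2_solution :
  solution mu L' (C (1 - r2)) (r2 / r1 * end_slope mu L') F.
Proof.
split => // y y01; have /andP[y0 y1] := y01.
have rr : r1 <= 1 - r2 by rewrite lerBrDr.
rewrite string_cos_gap// {1}/F CE; last exact: S2_01 y01.
rewrite /kern int_S2//; last first.
  exact: bm_kern_integrand.
rewrite mulrDr opprD addrA first_piece.
have -> : \int[mu]_(t in `[0, y])
    ((r2 * y + 1 - r2 - (r2 * t + 1 - r2)) * C (r2 * t + 1 - r2)) =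
    r2 * \int[mu]_(t in `[0, y]) ((y - t) * F t).
  rewrite -RintegralZl//; last by apply: bm_int => //; exact: bm_kern_integrand.
  by apply: eq_Rintegral => t _; rewrite /F; ring.
by rewrite /L' [r1 * m1]rm; field; rewrite gt_eqF.
Qed.

Lemma end_slope_S2 :
  r2 * end_slope mu L = slope mu L' (r2 / r1 * end_slope mu L') F 1.
Proof.
have r21 : r2 * 1 + 1 - r2 = 1 by ring.
have E := int_S2 one01 bC.
rewrite r21 in E.
rewrite {1}/end_slope {1}/slope E /slope.
have -> : \int[mu]_(t in I) C (r1 * t) = \int[mu]_(t in `[0, 1]) C' t.
  by apply: eq_Rintegral => t; rewrite inE/= in_itv/= => /string_cos_S1.
rewrite /end_slope /slope -/F.
rewrite [in X in _ = _ - X * _]/L' rm /L'; field.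
by rewrite gt_eqF.
Qed.

Lemma string_cos_even : end_slope mu L' = 0 ->
  [/\ end_slope mu L = 0,
      forall x, r1 <= x -> x <= 1 - r2 -> C x = C' 1,
      forall y, 0 <= y <= 1 -> F y = C' 1 * C' y
    & C 1 = C' 1 ^+ 2].
Proof.
move=> s0; have gap x : r1 <= x -> x <= 1 - r2 -> C x = C' 1.
  by move=> rx xr; rewrite string_cos_gap// s0 mulr0 addr0.
have FE : forall y, 0 <= y <= 1 -> F y = C' 1 * C' y.
  have rr : r1 <= 1 - r2 by rewrite lerBrDr.
  have := string_cos_S2_solution; rewrite s0 mulr0 (gap _ rr (lexx _)).
  exact: solution_eq_string_cos.
have C1 : C 1 = C' 1 ^+ 2.
  by rewrite expr2 -(FE _ one01) /F; congr string_cos; ring.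
split=> //.
apply/eqP; rewrite -(mulrI_eq0 _ (mulfI (lt0r_neq0 r2_gt0))) end_slope_S2 s0 mulr0.
by rewrite (eq_slope _ _ _ _ FE)// slopeZ// -/(end_slope mu L') s0 mulr0.
Qed.

Lemma string_cos_odd : end_slope mu L = 0 -> end_slope mu L' != 0 ->
  C 1 = - (m1 / m2).
Proof.
move=> s0 s'0.
have := wronskian (string_cos_solution mu L') string_cos_S2_solution.
rewrite -end_slope_S2 s0 -/(end_slope mu L') => E.
(* Both functions solve the equation for L', and F has slope 0 at 1, so the Wronskian identity reads
   - s F(1) = (r2 / r1) s with s = [end_slope mu L']; moreover r2 / r1 = m1 / m2. *)
have {}E : end_slope mu L' * (F 1 + r2 / r1) = 0 by lra.
have -> : C 1 = F 1 by rewrite /F; congr string_cos; ring.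
move/eqP: E; rewrite mulf_eq0 (negbTE s'0) addr_eq0 => /eqP ->.
congr (- _); apply/eqP; rewrite eqr_div ?lt0r_neq0//.
by rewrite -rm mulrC.
Qed.

End Renormalization.

(** * Sign alternation of the end values *)

Lemma min_le0_max (R : realType) (x y : R) : x * y <= 0 ->
  Num.min x y <= 0 <= Num.max x y.
Proof.
rewrite ge_min le_max; case: (ltrgt0P x) => x0 //=.
- by rewrite pmulr_rle0// => ->.
- by rewrite nmulr_rle0// => ->.
Qed.

Lemma exists_small (R : realType) (a b c : R) : 0 < a -> 0 < b -> 0 < c ->
  exists t : R, [/\ 0 < t, t < a, t < b & t + t < c].
Proof.
move=> a0 b0 c0; exists (Num.min (Num.min a b) c / 3).
have m0 : 0 < Num.min (Num.min a b) c by rewrite !lt_min a0 b0.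
have [ma mb mc] : [/\ Num.min (Num.min a b) c <= a,
    Num.min (Num.min a b) c <= b & Num.min (Num.min a b) c <= c].
  by split; rewrite !ge_min lexx ?orbT.
by move: (Num.min _ c) m0 ma mb mc => m; split; lra.
Qed.

Section Alternation.
Variable R : realType.
Local Notation T := (measurableTypeR R).
Local Notation I := (`[0, 1]%classic : set T).
Variable mu : probability T R.
Hypothesis muI : mu I = 1%E.
Implicit Types (L x : R).

Let one01 : 0 <= (1 : R) <= 1. Proof. by rewrite lexx ler01. Qed.

Let bC L : bounded_measurable (string_cos mu L). Proof. exact: bm_string_cos. Qed.

Lemma Rintegral01_cst (a : R) : \int[mu]_(t in I) a = a.
Proof. by rewrite Rintegral_cst// (congr1 fine muI) mulr1. Qed.

Lemma le_Rintegral_sub_itv x (f : R -> R) : x <= 1 -> bounded_measurable f ->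
  (forall t, 0 <= t <= 1 -> 0 <= f t) ->
  \int[mu]_(t in `[0, x]) f t <= \int[mu]_(t in I) f t.
Proof.
move=> x1 bf f0; rewrite Rintegral_0itv//; apply: le_Rintegral => //.
- by apply: bm_int => //; exact: bm_if_le.
- exact: bm_int.
- by move=> t; rewrite /= in_itv/= => t01; case: ifPn => // _; exact: f0.
Qed.

(* If the integral of C ^ 2 vanished, [|C| <= e + C ^ 2 / (4 e)] for all e > 0
   would force kern C = 0, so that C = 1. *)
Lemma string_cos_sqr_gt0 L :
  0 < \int[mu]_(t in I) (string_cos mu L t * string_cos mu L t).
Proof.
set C := string_cos mu L.
have J0 : 0 <= \int[mu]_(t in I) (C t * C t).
  by apply: Rintegral_ge0 => t _; rewrite -expr2 sqr_ge0.
rewrite lt_neqAle J0 andbT; apply/negP => /eqP JE.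
have bCC : bounded_measurable (fun t => C t * C t) by apply: bmM; exact: bC.
have kern0 x : 0 <= x <= 1 -> kern mu C x = 0.
  move=> /[dup] x01 /andP[x0 x1]; apply/eqP; rewrite -normr_le0.
  apply/ler_addgt0Pl => e e0; rewrite addr0.
  have bCe : bounded_measurable (fun t => e + (4 * e)^-1 * (C t * C t)).
    by apply: bmD; [exact: bm_cst|exact: bmZ].
  have bk := bm_kern_integrand x (bC L).
  rewrite (le_trans (le_normr_Rintegral _ (bm_int mu x1 bk)))//.
  apply: (@le_trans _ _ (\int[mu]_(t in `[0, x]) (e + (4 * e)^-1 * (C t * C t)))).
    apply: le_Rintegral => //.
    - by apply: bm_int => //; exact: bm_norm.
    - exact: bm_int.
    - move=> t; rewrite /= in_itv/= => /andP[t0 tx].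
      rewrite normrM ger0_norm ?subr_ge0//.
      apply: (@le_trans _ _ `|C t|).
        by rewrite ler_piMl// lerBlDr (le_trans x1)// lerDl.
      rewrite -[C t * C t]expr2 -real_normK ?num_real//.
      rewrite -(@ler_pM2l _ (4 * e)) ?mulr_gt0// mulrDr mulrA mulfV ?gt_eqF ?mulr_gt0//.
      by rewrite mul1r; have := sqr_ge0 (`|C t| - 2 * e); lra.
  rewrite (le_trans (le_Rintegral_sub_itv x1 bCe _))//.
    move=> t _; have CC0 : 0 <= C t * C t by rewrite -expr2 sqr_ge0.
    by rewrite addr_ge0 ?(ltW e0)// mulr_ge0// invr_ge0 mulr_ge0// ltW.
  rewrite RintegralD//; last 2 first.
  - by apply: bm_int => //; exact: bm_cst.
  - by apply: bm_int => //; exact: bmZ.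
  by rewrite RintegralZl ?bm_int// -JE mulr0 addr0 Rintegral01_cst.
have C1 x : 0 <= x <= 1 -> C x = 1.
  move=> x01; have [_ /(_ x x01)] := string_cos_solution mu L.
  by rewrite kern0// mulr0 subr0 mul0r addr0.
have : \int[mu]_(t in I) (C t * C t) = 1.
  rewrite -[RHS]Rintegral01_cst; apply: eq_Rintegral => t.
  by rewrite inE/= in_itv/= => t01; rewrite C1// mulr1.
by rewrite -JE => /eqP; rewrite eq_sym oner_eq0.
Qed.

(** The difference d of the two cosines satisfies d + L' [kern] d = -(L' - L) [kern] C_L, to which
    [gronwall] applies. Restricting to |L' - L| <= 1 bounds |L'| by |L| + 1, so K depends on L
    alone. *)
Lemma string_cos_lipschitz L : exists2 K : R, 0 <= K &
  forall L' x, `|L' - L| <= 1 -> 0 <= x <= 1 ->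
    `|string_cos mu L' x - string_cos mu L x| <= K * `|L' - L|.
Proof.
have [_ [M CM]] := bC L.
have M0 : 0 <= M by rewrite (le_trans _ (CM 1 one01)).
exists (2 * M * expR (2 * (`|L| + 1) + 1)).
  by rewrite !mulr_ge0// expR_ge0.
move=> L' x LL' x01.
have := @gronwall _ mu (`|L' - L| * M) (- L')
  (fun x => string_cos mu L' x - string_cos mu L x) (bmB (bC L') (bC L)).
rewrite mulr_ge0// => /(_ isT) G.
apply: (le_trans (G _ x x01)).
  move=> y /[dup] y01 /andP[y0 y1].
  rewrite kernB//.
  have [_ /(_ y y01) ->] := string_cos_solution mu L'.
  have [_ /(_ y y01) ->] := string_cos_solution mu L.
  apply: (@le_trans _ _ `|(L' - L) * kern mu (string_cos mu L) y|).
    rewrite -normrN; move: (kern mu _ y) (kern mu _ y) => k' k.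
    by rewrite le_eqVlt; apply/orP; left; apply/eqP; congr `|_|; ring.
  by rewrite normrM ler_wpM2l// le_kern_cst.
rewrite [leLHS](_ : _ = 2 * M * expR (2 * `|- L'| + 1) * `|L' - L|); last by ring.
rewrite ler_wpM2r// ler_wpM2l ?mulr_ge0// ler_expR lerD2r ler_wpM2l// normrN.
rewrite -[L'](subrK L) (le_trans (ler_normD _ _))//.
by rewrite addrC lerD2l.
Qed.

Lemma Rintegral_string_cos_mul_lipschitz L : exists2 K : R, 0 <= K &
  forall L', `|L' - L| <= 1 ->
    `|\int[mu]_(t in I) (string_cos mu L t * string_cos mu L' t) -
      \int[mu]_(t in I) (string_cos mu L t * string_cos mu L t)|
    <= K * `|L' - L|.
Proof.
have [K K0 CK] := string_cos_lipschitz L; have [_ [M CM]] := bC L.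
have M0 : 0 <= M by rewrite (le_trans _ (CM 1 one01)).
exists (M * K); first exact: mulr_ge0.
move=> L' LL'; rewrite -RintegralB//; last 2 first.
- by apply: bm_int => //; exact: bmM.
- by apply: bm_int => //; exact: bmM.
apply: le_normr_Rintegral_cst => //.
- by apply: bmB; exact: bmM.
- by rewrite !mulr_ge0.
- move=> t t01; rewrite -mulrBr normrM -mulrA ler_pM//; first exact: CM.
  exact: CK.
Qed.

Lemma end_slope_continuous : continuous (end_slope mu).
Proof.
have Jc : continuous (fun L => \int[mu]_(t in I) string_cos mu L t).
  move=> L; have [K K0 CK] := string_cos_lipschitz L.
  apply/cvgrPdist_lt => e e0; near=> L'.
  have LL' : `|L' - L| <= 1.
    rewrite distrC ltW//; near: L'; exact: (@cvgr_dist_lt _ _ _ (nbhs L) _ id _ _ _ ltr01).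
  rewrite -RintegralB//; last 2 first.
  - exact: bm_int.
  - exact: bm_int.
  rewrite (@le_lt_trans _ _ ((K + 1) * `|L' - L|))//; last first.
    rewrite mulrC -ltr_pdivlMr ?ltr_wpDl// distrC; near: L';
    apply: (@cvgr_dist_lt _ _ _ (nbhs L) _ id) => //.
    by rewrite divr_gt0// ltr_wpDl.
  apply: le_normr_Rintegral_cst => //.
  - by apply: bmB.
  - by rewrite mulr_ge0// addr_ge0.
  - move=> t t01; rewrite distrC (le_trans (CK _ _ LL' t01))//.
    by rewrite ler_wpM2r// lerDl.
move=> L; rewrite /end_slope /slope; apply: cvgB; first exact: cvg_cst.
by apply: cvgM; [exact: cvg_id|exact: Jc].
Unshelve. all: by end_near. Qed.

(** Since the slope at L1 vanishes, the Wronskian identity gives C_{L1}(1) [end_slope mu L] = (L1 -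
    L) times the integral of C_{L1} C_L, and that integral stays positive near L1. So the sign of
    C_{L1}(1) tells in which direction the end slope crosses zero. *)
Lemma end_slope_sign L1 : end_slope mu L1 = 0 -> exists2 d : R, 0 < d &
  forall L, `|L - L1| < d -> L != L1 ->
    0 < (L1 - L) * (string_cos mu L1 1 * end_slope mu L).
Proof.
move=> s0; have J0 := string_cos_sqr_gt0 L1.
have [K K0 JK] := Rintegral_string_cos_mul_lipschitz L1.
set J := \int[mu]_(t in I) _ in J0.
(* Within this radius the mixed integral differs from J by less than J; K + 1 avoids a zero
   denominator. *)
exists (Num.min 1 (J / (K + 1))).
  by rewrite lt_min ltr01 divr_gt0// ltr_wpDl.
move=> L; rewrite lt_min => /andP[L1L LJ] LL1.
have := wronskian (string_cos_solution mu L1) (string_cos_solution mu L).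
rewrite -!/(end_slope mu _) s0 !mul0r mulr0 subr0 sub0r oppr0 add0r => ->.
have sq : 0 < (L1 - L) * (L1 - L).
  by rewrite -expr2 lt_neqAle sqr_ge0 andbT eq_sym sqrf_eq0 subr_eq0 eq_sym.
rewrite mulrA; apply: (mulr_gt0 sq).
have := JK L (ltW L1L); rewrite -/J ler_norml => /andP[+ _].
have : K * `|L - L1| < J.
  apply: (@le_lt_trans _ _ ((K + 1) * `|L - L1|)).
    by rewrite ler_wpM2r// lerDl.
  by rewrite mulrC -ltr_pdivlMr// ltr_wpDl.
by move=> ? ?; lra.
Qed.

(** Just after L1 the end slope has the sign of -C_{L1}(1), just before L2 that of C_{L2}(1); with
    no zero in between, these signs agree. *)
Lemma string_cos_alternate L1 L2 : L1 < L2 ->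
  end_slope mu L1 = 0 -> end_slope mu L2 = 0 ->
  (forall L, L1 < L < L2 -> end_slope mu L != 0) ->
  string_cos mu L1 1 * string_cos mu L2 1 < 0.
Proof.
move=> L12 s1 s2 nz.
have [d1 d10 D1] := end_slope_sign s1; have [d2 d20 D2] := end_slope_sign s2.
have [t [t0 td1 td2 tL]] : exists t : R, [/\ 0 < t, t < d1, t < d2 & t + t < L2 - L1].
  by apply: exists_small => //; rewrite subr_gt0.
have a1 : 0 < (L1 - (L1 + t)) * (string_cos mu L1 1 * end_slope mu (L1 + t)).
  apply: D1; first by rewrite addrAC subrr add0r gtr0_norm.
  by rewrite -subr_eq0 addrAC subrr add0r gt_eqF.
have a2 : 0 < (L2 - (L2 - t)) * (string_cos mu L2 1 * end_slope mu (L2 - t)).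
  apply: D2; first by rewrite addrAC subrr add0r normrN gtr0_norm.
  by rewrite -subr_eq0 addrAC subrr add0r oppr_eq0 gt_eqF.
have {}a1 : string_cos mu L1 1 * end_slope mu (L1 + t) < 0.
  by move: a1; rewrite opprD addrA subrr add0r mulNr oppr_gt0 pmulr_rlt0.
have {}a2 : 0 < string_cos mu L2 1 * end_slope mu (L2 - t).
  by move: a2; rewrite opprB addrCA subrr addr0 pmulr_rgt0.
have ab : L1 + t <= L2 - t.
  by rewrite lerBrDr -addrA -lerBrDl ltW.
have ss : 0 < end_slope mu (L1 + t) * end_slope mu (L2 - t).
  rewrite ltNge; apply/negP => ss.
  have v : Num.min (end_slope mu (L1 + t)) (end_slope mu (L2 - t)) <= 0 <=
      Num.max (end_slope mu (L1 + t)) (end_slope mu (L2 - t)).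
    exact: min_le0_max.
  have cts : {within `[L1 + t, L2 - t], continuous (end_slope mu)}.
    exact: continuous_subspaceT end_slope_continuous.
  have [c + /eqP] := IVT ab cts v.
  rewrite in_itv/= => /andP[ac cb]; apply/negP; apply: nz.
  by rewrite (lt_le_trans _ ac) ?ltrDl// (le_lt_trans cb)// gtrBl.
have := nmulr_rlt0 (string_cos mu L2 1 * end_slope mu (L2 - t)) a1.
by rewrite a2 mulrACA pmulr_llt0.
Qed.

End Alternation.

(** * The L2 and supremum norms *)

Section Norms.
Import HBNNSimple.
Variable R : realType.
Local Notation T := (measurableTypeR R).
Local Notation I := (`[0, 1]%classic : set T).

(** Here f is measurable on D only: [L2norm] integrates over the whole line, while the eigenfunction
    series is controlled only on [0, 1]. The negligible part is therefore discarded for simple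
    functions below f. *)
Lemma ge0_integral_carrier (d : measure_display) (X : measurableType d)
    (nu : {measure set X -> \bar R}) (D : set X) (f : X -> \bar R) :
  measurable D -> nu (~` D) = 0%E -> measurable_fun D f ->
  (forall x, 0 <= f x)%E -> (\int[nu]_x f x = \int[nu]_(x in D) f x)%E.
Proof.
move=> mD D0 mf f0; apply/eqP; rewrite eq_le; apply/andP; split; last first.
  rewrite [leLHS]integral_mkcond !ge0_integralTE//; last first.
    by move=> x; rewrite patchE; case: ifPn.
  apply: ereal_sup_le => _ [h hf <-]; exists h => // x.
  by rewrite (le_trans (hf x))// patchE; case: ifPn.
rewrite ge0_integralTE//; apply: ge_ereal_sup => _ [h /= hf <-].
have mh : measurable_fun setT (fun x => (h x)%:E).
  exact/measurable_EFinP.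
rewrite -integralT_nnsfun (@ge0_negligible_integral _ _ _ nu _ (~` D))//.
- rewrite setTD setCK; apply: ge0_le_integral => //.
  + by move=> x _; rewrite lee_fin.
  + exact: measurable_funTS.
- exact: measurableC.
- by move=> x _; rewrite lee_fin.
Qed.

Lemma L2norm_sqrt (mu : probability T R) (f g : R -> R) : mu I = 1%E ->
  bounded_measurable g -> (forall x, 0 <= x <= 1 -> f x = g x) ->
  L2norm mu f = Num.sqrt (\int[mu]_(t in I) (g t * g t)).
Proof.
move=> muI bg fg; rewrite /L2norm unlock /=.
have mI : measurable I by exact: measurable_itv.
have mf : measurable_fun I f.
  by apply: eq_measurable_fun bg.1 => x; rewrite inE/= in_itv/= => /fg.
have -> : (\int[mu]_x `| (f x)%:E | `^ 2 = \int[mu]_x ((f x) ^+ 2)%:E)%E.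
  apply: eq_integral => x _.
  by rewrite abse_EFin poweR_EFin powR_mulrn// real_normK// num_real.
rewrite (@ge0_integral_carrier _ _ _ I)//; last 3 first.
- exact: probability_setC0.
- by apply/measurable_EFinP; exact: measurable_funX.
- by move=> x; rewrite lee_fin sqr_ge0.
have -> : (\int[mu]_(x in I) ((f x) ^+ 2)%:E =
    (\int[mu]_(t in I) (g t * g t))%:E)%E.
  rewrite /Rintegral fineK; last first.
    apply: integrable_fin_num => //; apply: bm_integrable => //.
      exact: probability_fin.
    exact: bmM.
  by apply: eq_integral => x; rewrite inE/= in_itv/= => x01; rewrite fg.
rewrite poweR_EFin/= powR12_sqrt//.
by apply: Rintegral_ge0 => t _; rewrite -expr2 sqr_ge0.
Qed.

Lemma le_sup_norm (f : R -> R) (x : R) : bounded_measurable f -> 0 <= x <= 1 ->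
  `|f x| <= sup_norm f.
Proof.
move=> [_ [M fM]] x01; apply: ub_le_sup.
  by exists M => _ [y + <-]; rewrite /= in_itv/=; exact: fM.
by exists x; rewrite //= in_itv.
Qed.

Lemma sup_norm_le (f : R -> R) (M : R) :
  (forall x, 0 <= x <= 1 -> `|f x| <= M) -> sup_norm f <= M.
Proof.
move=> fM; apply: ge_sup.
  by exists `|f 0|, 0; rewrite //= in_itv/= lexx ler01.
by move=> _ [y + <-]; rewrite /= in_itv/=; exact: fM.
Qed.

Lemma eq_sup_norm (f g : R -> R) : (forall x, 0 <= x <= 1 -> f x = g x) ->
  sup_norm f = sup_norm g.
Proof.
move=> fg; rewrite /sup_norm; congr sup; apply/seteqP.
by split => _ [x x01 <-]; exists x => //; rewrite fg//; rewrite /= in_itv in x01.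
Qed.

Lemma sup_normZ (a : R) (f : R -> R) : 0 < a -> bounded_measurable f ->
  sup_norm (fun x => a * f x) = a * sup_norm f.
Proof.
move=> a0 bf; apply/eqP; rewrite eq_le; apply/andP; split.
  apply: sup_norm_le => x x01; rewrite normrM (gtr0_norm a0) ler_wpM2l ?(ltW a0)//.
  exact: le_sup_norm.
rewrite -ler_pdivlMl//; apply: sup_norm_le => x x01.
rewrite ler_pdivlMl//; have := le_sup_norm (bmZ a bf) x01.
by rewrite normrM (gtr0_norm a0).
Qed.

End Norms.

(** * Doubling of indices, and the norms of the eigenfunctions *)

Lemma index_doubling (R : realType) (lam : nat -> R) (c : R) : 0 < c ->
  {homo lam : i j / (i < j)%N >-> i < j} ->
  (forall j, ~~ odd j <-> exists i, c * lam j = lam i) ->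
  (forall i, exists j, lam i = c * lam j) ->
  forall m, c * lam (2 * m)%N = lam m.
Proof.
move=> c0 lam_lt even_img onto.
have lamI i j : lam i = lam j -> i = j.
  by case: (ltngtP i j) => // /lam_lt + E; rewrite E ltxx.
have lam_le i j : (i <= j)%N -> lam i <= lam j.
  by rewrite leq_eqVlt => /orP[/eqP->//|/lam_lt/ltW].
(* Let c lam(2m) = lam i and lam m = c lam(2n). Neither i < m nor n < m is possible, as the
   induction hypothesis and injectivity would identify the indices. Hence lam m <= lam i = c lam(2m)
   <= c lam(2n) = lam m. *)
elim/ltn_ind => m IH.
have [i iE] : exists i, c * lam (2 * m)%N = lam i.
  by apply/even_img; rewrite oddM.
have mi : (m <= i)%N.
  rewrite leqNgt; apply/negP => im; have := im.
  have := IH _ im; rewrite -iE => /(mulfI (lt0r_neq0 c0)) /lamI /eqP.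
  by rewrite eqn_mul2l/= => /eqP ->; rewrite ltnn.
have [j jE] := onto m.
have /even_img jeven : exists i, c * lam j = lam i by exists m.
have {jE} jE : lam m = c * lam (2 * j./2)%N.
  by rewrite jE mul2n -[in LHS](odd_double_half j) (negbTE jeven).
have mj : (m <= j./2)%N.
  rewrite leqNgt; apply/negP => jm; have := jm.
  by have := IH _ jm; rewrite -jE => /lamI <-; rewrite ltnn.
apply/eqP; rewrite eq_le; apply/andP; split; last by rewrite iE lam_le.
by rewrite jE ler_pM2l// lam_le// leq_mul2l.
Qed.

Section Spectrum.
Variable R : realType.
Local Notation T := (measurableTypeR R).
Local Notation I := (`[0, 1]%classic : set T).
Variables (r1 r2 m1 m2 : R) (mu : probability T R) (lam : nat -> R).
Hypotheses (r1_gt0 : 0 < r1) (r2_gt0 : 0 < r2) (m1_gt0 : 0 < m1) (m2_gt0 : 0 < m2).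
Hypotheses (r_le1 : r1 + r2 <= 1) (m_eq1 : m1 + m2 = 1) (rm : r1 * m1 = r2 * m2).
Hypothesis mu_ss : self_similar_measure r1 r2 m1 m2 mu.
Hypothesis lam_spec : neumann_spectrum mu lam.

Let muI : mu I = 1%E. Proof. by case: mu_ss. Qed.

Let lam_lt : {homo lam : i j / (i < j)%N >-> i < j}. Proof. by case: lam_spec. Qed.

Let one01 : 0 <= (1 : R) <= 1. Proof. by rewrite lexx ler01. Qed.

Let lam_le i j : (i <= j)%N -> lam i <= lam j.
Proof. by rewrite leq_eqVlt => /orP[/eqP->//|/lam_lt/ltW]. Qed.

Let end_slopeP L : end_slope mu L = 0 <-> exists i, lam i = L.
Proof.
have [_ E] := lam_spec.
have mu0 : mu [set 0] = 0%E.
  exact: (self_similar_set1 r1_gt0 r2_gt0 m2_gt0 r_le1 m_eq1 mu_ss).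
rewrite -(neumann_eigenvalueP _ mu0).
rewrite -[neumann_eigenvalue mu L]/([set L | neumann_eigenvalue mu L] L).
by rewrite -E; split => [[i _ <-]|[i <-]]; exists i.
Qed.

(** This fixes which parity of the index carries the positive end values: for L = 0 the end value is
    positive. *)
Let lam0 : lam 0%N = 0.
Proof.
have [i iE] : exists i, lam i = 0.
  by apply/end_slopeP; rewrite /end_slope /slope mul0r subr0.
apply/eqP; rewrite eq_le -{1}iE lam_le//= leNgt; apply/negP.
move=> /(end_slope_gt0 muI); rewrite (_ : end_slope _ _ = 0) ?ltxx//.
by apply/end_slopeP; exists 0%N.
Qed.

Let lam_ge0 m : 0 <= lam m. Proof. by rewrite -lam0 lam_le. Qed.

Let a m : R := string_cos mu (lam m) 1.

Let a_sign j : if odd j then a j < 0 else 0 < a j.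
Proof.
elim: j => [|j IHj].
  by rewrite /a lam0 (lt_le_trans ltr01)// string_cos_ge1.
have alt : a j * a j.+1 < 0.
  apply: string_cos_alternate => //; first exact: lam_lt.
  - by apply/end_slopeP; exists j.
  - by apply/end_slopeP; exists j.+1.
  move=> L /andP[jL Lj]; apply/eqP => /end_slopeP[i iE].
  move: jL Lj; rewrite -iE.
  case: (leqP i j) => [/lam_le ij + _|/lam_le ji _ +].
    by rewrite ltNge ij.
  by rewrite ltNge ji.
move: IHj alt; rewrite /=; case: (odd j) => /= aj.
  by rewrite nmulr_rlt0.
by rewrite pmulr_rlt0.
Qed.

Let even_split L := string_cos_even r1_gt0 r2_gt0 m1_gt0 m2_gt0
  r_le1 m_eq1 rm mu_ss (L := L).

Let odd_value L := string_cos_odd r1_gt0 r2_gt0 m1_gt0 m2_gt0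
  r_le1 m_eq1 rm mu_ss (L := L).

Let c := r1 * m1.
Let c_gt0 : 0 < c. Proof. exact: mulr_gt0. Qed.

Let evenP j : ~~ odd j <-> end_slope mu (c * lam j) = 0.
Proof.
have sj : end_slope mu (lam j) = 0 by apply/end_slopeP; exists j.
split=> [jeven|].
  apply/eqP/negPn/negP => s'; have := a_sign j; rewrite (negbTE jeven).
  by rewrite /a (odd_value sj s') oppr_gt0 ltNge ltW// divr_gt0.
move=> /even_split[_ _ _ aE]; have := a_sign j; case: (odd j) => //.
by rewrite /a aE ltNge sqr_ge0.
Qed.

Lemma lam_doubling m : c * lam (2 * m)%N = lam m.
Proof.
apply: index_doubling => // [j|i].
  rewrite evenP; split => [/end_slopeP[i iE]|[i iE]]; first by exists i.
  by apply/end_slopeP; exists i.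
(* The even case for L = c^(-1) lam i shows that this L is an eigenvalue, so every eigenvalue is c
   times another. *)
have /even_split[s0 _ _ _] : end_slope mu (c * (c^-1 * lam i)) = 0.
  by rewrite mulVKf ?lt0r_neq0//; apply/end_slopeP; exists i.
by move/end_slopeP: s0 => [j jE]; exists j; rewrite jE mulVKf ?lt0r_neq0.
Qed.

Let lam_doubled m : end_slope mu (c * lam (2 * m)%N) = 0.
Proof. by rewrite lam_doubling; apply/end_slopeP; exists m. Qed.

(** The end value is -m1 / m2 at an odd index and is squared by each doubling. *)
Lemma normr_a k l : odd l -> `|a (2 ^ k * l)| = (m1 / m2) ^+ (2 ^ k).
Proof.
move=> lodd; elim: k => [|k IHk].
  rewrite mul1n expr1 /a odd_value.
  - by rewrite normrN gtr0_norm ?divr_gt0.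
  - by apply/end_slopeP; exists l.
  - by apply/eqP => /evenP; rewrite lodd.
rewrite expnS -mulnA; have [_ _ _ aE] := even_split (lam_doubled (2 ^ k * l)).
rewrite /a aE; rewrite -/c lam_doubling normrX -/(a _) IHk.
by rewrite -exprM mulnC.
Qed.

Local Notation f := (neumann_eigenfunction mu lam).
Local Notation C m := (string_cos mu (lam m)).

Let fE m x : 0 <= x <= 1 -> f m x = C m x.
Proof. exact: c_fun_string_cos. Qed.

Let bC m : bounded_measurable (C m). Proof. exact: bm_string_cos. Qed.

Let CS1 m y : 0 <= y <= 1 -> C (2 * m)%N (r1 * y) = C m y.
Proof.
move=> y01; rewrite -[in RHS]lam_doubling.
exact: (string_cos_S1 r1_gt0 r2_gt0 m1_gt0 m2_gt0 r_le1 m_eq1 mu_ss).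
Qed.

Let CS2 m y : 0 <= y <= 1 -> C (2 * m)%N (r2 * y + 1 - r2) = a m * C m y.
Proof.
move=> y01; have [_ _ E _] := even_split (lam_doubled m).
by rewrite (E y y01) -/c lam_doubling.
Qed.

Let Cgap m x : r1 <= x -> x <= 1 - r2 -> C (2 * m)%N x = a m.
Proof.
move=> rx xr; have [_ E _ _] := even_split (lam_doubled m).
by rewrite (E x rx xr) -/c lam_doubling.
Qed.

Lemma L2norm_eigenfunction m :
  L2norm mu (f m) = Num.sqrt (\int[mu]_(t in I) (C m t * C m t)).
Proof. by apply: L2norm_sqrt => //; exact: fE. Qed.

Lemma L2norm_gt0 m : 0 < L2norm mu (f m).
Proof. by rewrite L2norm_eigenfunction sqrtr_gt0 string_cos_sqr_gt0. Qed.

(** The left copy of C_m has weight m1 and factor 1, the right copy weight m2 and factor [a m]; the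
    gap has no mass. *)
Lemma L2norm_doubling m :
  L2norm mu (f (2 * m)%N) = Num.sqrt (m1 + m2 * a m ^+ 2) * L2norm mu (f m).
Proof.
rewrite !L2norm_eigenfunction -sqrtrM; last first.
  by rewrite addr_ge0 ?(ltW m1_gt0)// mulr_ge0 ?sqr_ge0 ?(ltW m2_gt0).
congr Num.sqrt.
have bCC n : bounded_measurable (fun t => C n t * C n t) by apply: bmM; exact: bC.
have := Rintegral_self_similar_S2 r1_gt0 r2_gt0 m1_gt0 m2_gt0 r_le1 mu_ss one01
  (bCC (2 * m)%N).
have -> : r2 * 1 + 1 - r2 = 1 by rewrite mulr1 addrAC subrr add0r.
have -> : \int[mu]_(t in I) (C (2 * m)%N (r1 * t) * C (2 * m)%N (r1 * t)) =
    \int[mu]_(t in I) (C m t * C m t).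
  by apply: eq_Rintegral => t; rewrite inE/= in_itv/= => t01; rewrite CS1.
have -> : \int[mu]_(t in `[0, 1])
      (C (2 * m)%N (r2 * t + 1 - r2) * C (2 * m)%N (r2 * t + 1 - r2)) =
    a m ^+ 2 * \int[mu]_(t in I) (C m t * C m t).
  rewrite -RintegralZl//; last by apply: bm_int => //; exact: bCC.
  apply: eq_Rintegral => t; rewrite inE/= in_itv/= => t01.
  by rewrite CS2// mulrACA -expr2.
by move=> ->; rewrite mulrDl mulrA.
Qed.

Lemma sup_norm_eigenfunction m : sup_norm (f m) = sup_norm (C m).
Proof. exact/eq_sup_norm/fE. Qed.

(** The gap adds nothing: its constant value [a m] is C_m(1), already bounded by the norm of the
    left copy. *)
Lemma sup_norm_doubling m :
  sup_norm (f (2 * m)%N) = Num.max 1 `|a m| * sup_norm (f m).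
Proof.
rewrite !sup_norm_eigenfunction.
have S0 : 0 <= sup_norm (C m) by rewrite (le_trans _ (le_sup_norm (bC m) one01)).
have max0 : 0 < Num.max 1 `|a m| by rewrite lt_max ltr01.
apply/eqP; rewrite eq_le; apply/andP; split.
  apply: sup_norm_le => x /andP[x0 x1].
  have [xr1|r1x] := leP x r1.
    have y01 : 0 <= x / r1 <= 1.
      by rewrite divr_ge0 ?(ltW r1_gt0)//= ler_pdivrMr// mul1r.
    rewrite -[x](@divfK _ r1) ?lt0r_neq0// mulrC CS1//.
    rewrite (le_trans (le_sup_norm (bC m) y01))//.
    by rewrite ler_peMl// le_max lexx.
  have [xr2|r2x] := leP x (1 - r2).
    rewrite Cgap ?(ltW r1x)// (le_trans (le_sup_norm (bC m) one01))//.
    by rewrite ler_peMl// le_max lexx.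
  have y01 : 0 <= (x - (1 - r2)) / r2 <= 1.
    rewrite divr_ge0 ?(ltW r2_gt0) ?subr_ge0 ?(ltW r2x)//= ler_pdivrMr// mul1r.
    by rewrite lerBlDr subrKC.
  have -> : x = r2 * ((x - (1 - r2)) / r2) + 1 - r2.
    by rewrite mulrC divfK ?lt0r_neq0// -addrA subrK.
  rewrite CS2// normrM ler_pM//; first by rewrite le_max lexx orbT.
  exact: le_sup_norm.
rewrite -ler_pdivlMl//; apply: sup_norm_le => y y01; rewrite ler_pdivlMl//.
rewrite maxr_pMl// ge_max mul1r -normrM; apply/andP; split.
  by rewrite -CS1// le_sup_norm//; exact: (S1_itv01 r1_gt0 r2_gt0 r_le1).
by rewrite -CS2// le_sup_norm//; exact: (S2_itv01 r1_gt0 r2_gt0 r_le1).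
Qed.

Lemma sup_norm_normalized m : sup_norm (normalized_eigenfunction mu lam m) =
  (L2norm mu (f m))^-1 * sup_norm (f m).
Proof.
rewrite sup_norm_eigenfunction -sup_normZ ?invr_gt0 ?L2norm_gt0//.
by apply: eq_sup_norm => x x01; rewrite /normalized_eigenfunction fE.
Qed.

Lemma sup_norm_normalized_doubling k l : odd l ->
  sup_norm (normalized_eigenfunction mu lam (2 * (2 ^ k * l))) =
  Num.max 1 ((m1 / m2) ^+ (2 ^ k))
  / Num.sqrt (m1 + m2 * (m1 / m2) ^+ (2 ^ k.+1))
  * sup_norm (normalized_eigenfunction mu lam (2 ^ k * l)).
Proof.
move=> lodd; rewrite !sup_norm_normalized L2norm_doubling sup_norm_doubling.
rewrite -[a _ ^+ 2]real_normK ?num_real// normr_a// -exprM expnSr invfM.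
by rewrite mulrACA [in RHS]mulrA [_^-1 * Num.max _ _]mulrC !mulrA.
Qed.

End Spectrum.

(** For q = m1 / m2 <= 1 the maximum is 1. Because m2 q = m1, one factor q splits off: m1 + m2
    q^(2^j) = m1 (1 + q^(2^j - 1)), the source of the exponent 2^j - 1 and of one factor m1^(-1/2)
    per doubling. *)
Lemma doubling_product (R : realType) (m1 m2 : R) (N : nat -> R) :
  0 < m1 -> m1 <= m2 ->
  (forall k, N k.+1 = Num.max 1 ((m1 / m2) ^+ (2 ^ k))
                    / Num.sqrt (m1 + m2 * (m1 / m2) ^+ (2 ^ k.+1)) * N k) ->
  forall k, N k = m1 `^ (- (k%:R / 2))
    * (\prod_(1 <= j < k.+1) (1 + (m1 / m2) ^+ (2 ^ j - 1)) `^ (- (1 / 2))) * N 0%N.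
Proof.
move=> m1_gt0 m12 NS; have m2_gt0 := lt_le_trans m1_gt0 m12.
have q0 : 0 < m1 / m2 by rewrite divr_gt0.
have half (x : R) : 0 <= x -> x `^ (- (1 / 2)) = (Num.sqrt x)^-1.
  by move=> x0; rewrite powRN mul1r powR12_sqrt.
elim=> [|k IHk]; first by rewrite big_geq// mul0r oppr0 powRr0 !mul1r.
have q1 : (m1 / m2) ^+ (2 ^ k) <= 1.
  by rewrite exprn_ile1 ?(ltW q0)// ler_pdivrMr// mul1r.
have p0 : 0 <= 1 + (m1 / m2) ^+ (2 ^ k.+1 - 1).
  by rewrite addr_ge0// exprn_ge0// ltW.
rewrite NS IHk [\prod_(1 <= j < k.+2) _]big_nat_recr//= (max_idPl q1).
have -> : m1 + m2 * (m1 / m2) ^+ (2 ^ k.+1) =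
    m1 * (1 + (m1 / m2) ^+ (2 ^ k.+1 - 1)).
  rewrite -[in LHS](@subnK 1 (2 ^ k.+1)) ?expn_gt0// addn1 exprS.
  by rewrite mulrA [m2 * _]mulrC divfK ?lt0r_neq0// mulrDr mulr1.
have -> : - (k.+1%:R / 2) = - (k%:R / 2) + - (1 / 2) :> R.
  by rewrite -natr1; field.
rewrite powRD ?lt0r_neq0 ?implybT// !half ?(ltW m1_gt0)//.
by rewrite sqrtrM ?(ltW m1_gt0)// invfM/=; ring.
Qed.

Theorem theorem8p6 (R : realType) (r1 r2 m1 m2 : R)
    (mu : probability (measurableTypeR R) R) (lam : nat -> R)
    (r1_gt0 : 0 < r1) (r2_gt0 : 0 < r2) (m1_gt0 : 0 < m1) (m2_gt0 : 0 < m2)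
    (r_le1 : r1 + r2 <= 1) (m_eq1 : m1 + m2 = 1) (rm : r1 * m1 = r2 * m2)
    (mu_ss : self_similar_measure r1 r2 m1 m2 mu)
    (lam_spec : neumann_spectrum mu lam) :
  (forall m : nat, (0 < m)%N ->
     sup_norm (normalized_eigenfunction mu lam (2 * m)) =
       Num.max 1 ((m1 / m2) ^+ (2 ^ logn 2 m))
       / Num.sqrt (m1 + m2 * (m1 / m2) ^+ (2 ^ (logn 2 m).+1))
       * sup_norm (normalized_eigenfunction mu lam m))
  /\
  (m1 <= m2 -> forall l : nat, odd l -> forall k : nat, (0 < k)%N ->
     sup_norm (normalized_eigenfunction mu lam (2 ^ k * l)) =
       m1 `^ (- (k%:R / 2))
       * (\prod_(1 <= j < k.+1) (1 + (m1 / m2) ^+ (2 ^ j - 1)) `^ (- (1 / 2)))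
       * sup_norm (normalized_eigenfunction mu lam l)).
Proof.
have doubling := sup_norm_normalized_doubling r1_gt0 r2_gt0 m1_gt0 m2_gt0
  r_le1 m_eq1 rm mu_ss lam_spec.
split=> [m m_gt0|m12 l lodd k _].
  (* Write m = 2^v l with l odd and v = [logn 2 m]. *)
  have [l l2 mE] := pfactor_coprime (isT : prime 2) m_gt0.
  have lodd : odd l by rewrite -coprime2n.
  move: (logn 2 m) mE => v ->; rewrite [(l * _)%N]mulnC.
  exact: doubling.
pose N j := sup_norm (normalized_eigenfunction mu lam (2 ^ j * l)).
have := @doubling_product _ m1 m2 N m1_gt0 m12 _ k.
rewrite /N mul1n; apply => j.
have -> : (2 ^ j.+1 * l = 2 * (2 ^ j * l))%N by rewrite expnS mulnA.
exact: doubling.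
Qed.
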